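(* Let $n\ge 1$ and $d\ge 2$ be integers. The following are equivalent. (i) For every nonempty $M$-convex support $S\subseteq\Delta_n^d$, one has $\operatorname{BR}(\mathcal L_S^+)=\operatorname{Cone}(\mathcal G_n(S))$. (ii) One has $n\le 3$, or $d=2$, or $(n,d)=(4,3)$. Moreover, whenever (ii) fails, the equality already fails for full support: $\operatorname{Cone}(\mathcal G_n(\Delta_n^d))\subsetneq\operatorname{BR}(\mathcal L_{n,d}^+)$.
   Context: Notation: $\mathbb N=\mathbb Z_{\ge0}$, $[n]=\{1,\dots,n\}$, $e_i$ is the $i$-th standard basis vector of $\mathbb R^n$; for $\alpha\in\mathbb N^n$, $|\alpha|=\alpha_1+\cdots+\alpha_n$, $\alpha!=\alpha_1!\cdots\alpha_n!$, and $\mathbf x^\alpha=x_1^{\alpha_1}\cdots x_n^{\alpha_n}$; $\Delta_n^d=\{\alpha\in\mathbb N^n:|\alpha|=d\}$. For a finite set $S$, $\varepsilon_\alpha$ ($\alpha\in S$) denotes the standard basis of $\mathbb R^S$. $\operatorname{Cone}(E)$ is the set of finite nonnegative linear combinations of elements of $E$. A nonempty set $S\subseteq\Delta_n^d$ is $M$-convex if, whenever $\alpha,\beta\in S$ and $\alpha_i>\beta_i$, there is $j$ with $\alpha_j<\beta_j$ such that $\alpha-e_i+e_j\in S$ and $\beta-e_j+e_i\in S$. Lorentzian polynomials: for $d\ge2$, a polynomial $f=\sum_{\alpha\in\Delta_n^d}c_\alpha\,\mathbf x^\alpha/\alpha!$ with all $c_\alpha\ge0$, not identically zero, is Lorentzian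 if and only if its support $\{\alpha:c_\alpha\ne0\}$ is $M$-convex and for every $\beta\in\Delta_n^{d-2}$ the symmetric matrix $H_\beta(f)=(c_{\beta+e_i+e_j})_{1\le i,j\le n}$ (the Hessian of $\partial^\beta f$) has at most one positive eigenvalue. The numbers $c_\alpha$ are called the normalized coefficients of $f$. For an $M$-convex $S\subseteq\Delta_n^d$, $\mathcal L_S^+$ is the set of Lorentzian polynomials whose normalized coefficients $c_\alpha$ are positive exactly for $\alpha\in S$; $\mathcal L_{n,d}^+:=\mathcal L_{\Delta_n^d}^+$. For $w\in\mathbb R^S$ and $f\in\mathcal L_S^+$ put $R_w(f)=\prod_{\alpha\in S}c_\alpha^{w_\alpha}$, and $\operatorname{BR}(\mathcal L_S^+)=\{w\in\mathbb R^S:\sup_{f\in\mathcal L_S^+}R_w(f)<\infty\}$. Quadratic local generators: for $\beta\in\Delta_n^{d-2}$ let $S_\beta=\{e_i+e_j:i,j\in[n],\ \beta+e_i+e_j\in S\}\subseteq\Delta_n^2$ (which is $M$-convex whenever nonempty). For $v\in\mathbb R^{S_\beta}$ let $\widetilde v^{\,\beta}=\sum_{\gamma\in S_\beta}v_\gamma\varepsilon_{\beta+\gamma}\in\mathbb R^S$. Then $\mathcal G_n(S)=\bigcup_{\beta\in\Delta_n^{d-2},\,S_\beta\ne\varnothing}\{\widetilde v^{\,\beta}:v\in\operatorname{BR}(\mathcal L_{S_\beta}^+)\}$. *)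

(* Defs.v *)
From HB Require Import structures.
From mathcomp Require Import all_boot all_order all_algebra finmap.
From mathcomp Require Import boolp classical_sets reals exp.
(* The notations of mpoly clash with those of mathcomp-analysis. *)
From mathcomp Require Import -(notations) mpoly.

Set Implicit Arguments.
Unset Strict Implicit.
Unset Printing Implicit Defensive.

Import Order.TTheory GRing.Theory Num.Theory.

Local Open Scope classical_set_scope.
Local Open Scope fset_scope.
Local Open Scope ring_scope.

Declare Scope mnm_scope.
Delimit Scope mnm_scope with mnm.
Bind Scope mnm_scope with multinom.
Notation "a + b" := (mnm_add a b) : mnm_scope.
Notation "a - b" := (mnm_sub a b) : mnm_scope.
Notation "'e_ i" := (mnm1 i) (at level 8, i at level 2, format "''e_' i")
  : mnm_scope.

Definition Delta (n d : nat) : {fset multinom n} :=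
  [fset bmnm m | m in {: bmultinom n d.+1} & mdeg (bmnm m) == d].

(* The truncated subtractions are exact: a i > b i gives a i > 0, and
   a j < b j gives b j > 0. *)
Definition Mconvex (n d : nat) (S : {fset multinom n}) : Prop :=
  [/\ S != fset0, S `<=` Delta n d &
   forall (a b : multinom n) (i : 'I_n), a \in S -> b \in S -> (b i < a i)%N ->
     exists j : 'I_n, [/\ (a j < b j)%N, (a - 'e_i + 'e_j)%mnm \in S
                        & (b - 'e_j + 'e_i)%mnm \in S]].

Section Lorentzian.
Variable R : realType.

(* Used for symmetric A only, where the dimension of the eigenspace is the
   multiplicity of the eigenvalue; \rank (eigenspace A x) = 0 when x is not
   an eigenvalue of A. *)
Definition at_most_one_pos_eigenvalue (n : nat) (A : 'M[R]_n) : Prop :=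
  forall s : seq R, uniq s -> all (fun x => 0 < x) s ->
    (\sum_(x <- s) \rank (eigenspace A x) <= 1)%N.

Variable n : nat.
Implicit Types (d : nat) (S : {fset multinom n}) (f : mpoly n R).

(* c_a, where f = \sum_a c_a x^a / a! *)
Definition ncoeff f (a : multinom n) : R :=
  (\prod_(i < n) (a i)`!)%:R * mcoeff a f.

Definition hess f (b : multinom n) : 'M[R]_n :=
  \matrix_(i, j) ncoeff f (b + 'e_i + 'e_j)%mnm.

Definition Lorentzian d f : Prop :=
  [/\ f \is ishomog1 d mdeg, f != 0, (forall a, 0 <= ncoeff f a),
      Mconvex d [fset a in Delta n d | ncoeff f a != 0]
    & forall b, (mdeg b + 2)%N = d -> at_most_one_pos_eigenvalue (hess f b)].

Definition Lplus d S : set (mpoly n R) :=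
  [set f | Lorentzian d f /\ forall a, 0 < ncoeff f a <-> a \in S].

(* R^S is {ffun S -> R^o}, the regular module R^o providing its structure of
   R-module. *)
Definition Rmon S (w : {ffun S -> R^o}) f : R :=
  \prod_(a : S) (ncoeff f (val a) `^ w a).

Definition BR d S : set {ffun S -> R^o} :=
  [set w | has_ubound [set Rmon w f | f in Lplus d S]].

Definition Cone (V : lmodType R) (E : set V) : set V :=
  [set x | exists (k : nat) (u : 'I_k -> V) (c : 'I_k -> R),
     [/\ forall i, E (u i), forall i, 0 <= c i & x = \sum_(i < k) c i *: u i]].

Definition Sloc S (b : multinom n) : {fset multinom n} :=
  [fset g in [fset ('e_i + 'e_j)%mnm | i in 'I_n, j in 'I_n]
     | (b + g)%mnm \in S].

Definition eps S (a : multinom n) : {ffun S -> R^o} :=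
  [ffun x : S => (val x == a)%:R].

Definition lift_loc S (b : multinom n) (v : {ffun Sloc S b -> R^o}) :
    {ffun S -> R^o} :=
  \sum_(g : Sloc S b) v g *: eps S (b + val g)%mnm.

Definition local_gens d S : set {ffun S -> R^o} :=
  [set u | exists (b : multinom n) (v : {ffun Sloc S b -> R^o}),
     [/\ (mdeg b + 2)%N = d, Sloc S b != fset0, BR 2 v & u = lift_loc v]].

End Lorentzian.

Arguments BR R {n} d S.
Arguments local_gens R {n} d S.

(* Main.v *)
(** Taking [nu = - log c] turns a bounded ratio [w] into a linear functional
    bounded below on the logarithmic coefficients of Lorentzian polynomials.
    If [nu] satisfies the tropical four-point condition (the least two of
    [nu ij + nu kl], [nu ik + nu jl], [nu il + nu jk] agree, in every Hessian),
    then [expR (- t * nu)] are the normalized coefficients of a Lorentzian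
    polynomial for every [t >= 0], so bounded ratios are nonnegative on tropical
    functions.  Conversely Lorentzian polynomials satisfy the four-point
    conditions up to an additive constant, by the reversed Cauchy-Schwarz
    inequality.

    The part of the four-point condition that is linear in [nu] is dual to
    explicit local generators.  By Farkas' lemma, equality in (i) follows once
    every function satisfying the linear part is a sum of tropical ones; for
    [n <= 3] it is tropical itself, and for [(n, d) = (4, 3)] it splits because
    the four nonlinear conditions involve disjoint sets of values.

    For full support, [n >= 4] and [d >= 4], or [n >= 5] and [d = 3], a sum of
    two or three crossing functions [|a(A) - c|], raised by a small bump,
    is locally a sum of tropical functions (the bump only replaces two crossing
    cuts by two nested ones), hence nonnegative on all local generators, but it
    is negative on an explicit bounded ratio. *)

Require Import Defs.
From HB Require Import structures.
From mathcomp Require Import all_boot all_order all_algebra finmap.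
From mathcomp Require Import sesquilinear spectral complex.
From mathcomp Require Import boolp classical_sets reals sequences exp.
From mathcomp Require Import -(notations) mpoly.
From mathcomp Require Import ring lra zify.

Set Implicit Arguments.
Unset Strict Implicit.
Unset Printing Implicit Defensive.

Import Order.TTheory GRing.Theory Num.Theory.

Local Open Scope fset_scope.
Local Open Scope ring_scope.

(** * Signature of symmetric matrices *)

(** The bounded ratios of quadratics are never determined. Equality needs only explicit generators,
    each a ratio bounded by 4; strictness needs only that tropical functions pair nonnegatively with
    every bounded ratio of degree 2.

    The obstacle is that tropical functions do not form a convex set: a sum of them may violate the
    nonlinear four-point conditions, yet bounded ratios stay nonnegative on it. For [(4, 3)] this
    room is enough to reach every function satisfying the linear part. In the larger cases it is
    also the source of the gap: splittings into tropical functions around the different [b] need not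
    come from one global splitting.

    Eigenvalues enter only through the reversed Cauchy-Schwarz inequality, which can be tested on
    chosen vectors and passes to limits. Limits are needed because a support smaller than the
    simplex puts zeros into the Hessians. Missing entries also turn nonlinear conditions into linear
    equalities, hence the case distinctions on rows for [(4, 3)]. *)

Section Hyperbolic.
Variables (R : realType) (n : nat).
Implicit Types (A : 'M[R]_n) (x y z : 'rV[R]_n).

Definition bil A x y : R := (x *m A *m y^T) 0 0.

(** The reversed Cauchy-Schwarz inequality. For symmetric [A] it is equivalent to having at most one
    positive eigenvalue; both directions are proved below. *)
Definition hyperbolic A : Prop :=
  forall x y, 0 < bil A x x -> bil A x x * bil A y y <= bil A x y ^+ 2.

Lemma bilE A x y : bil A x y = \sum_i \sum_j x 0 i * A i j * y 0 j.
Proof.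
rewrite /bil mxE exchange_big; apply: eq_bigr => j _.
by rewrite !mxE mulr_suml; apply: eq_bigr => i _.
Qed.

Lemma bilDl A x y z : bil A (x + y) z = bil A x z + bil A y z.
Proof. by rewrite /bil !mulmxDl mxE. Qed.

Lemma bilDr A x y z : bil A z (x + y) = bil A z x + bil A z y.
Proof. by rewrite /bil linearD mulmxDr mxE. Qed.

Lemma bilZl A (a : R) x y : bil A (a *: x) y = a * bil A x y.
Proof. by rewrite /bil -!scalemxAl mxE. Qed.

Lemma bilZr A (a : R) x y : bil A y (a *: x) = a * bil A y x.
Proof. by rewrite /bil linearZ -scalemxAr mxE. Qed.

Lemma bilC A x y : A^T = A -> bil A x y = bil A y x.
Proof.
move=> As; rewrite /bil.
have -> : (x *m A *m y^T) 0 0 = ((x *m A *m y^T)^T) 0 0 by rewrite [RHS]mxE.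
by rewrite !trmx_mul trmxK As mulmxA.
Qed.

End Hyperbolic.

Section Spectral.
Variables (R : realType) (n : nat) (A : 'M[R]_n).
Hypothesis A_sym : A^T = A.

Local Notation C := (R[i]).
Local Notation f := (real_complex R).
Local Notation Ac := (map_mx f A).
Local Notation P := (spectralmx Ac).
Local Notation D := (spectral_diag Ac).
Local Open Scope sesquilinear_scope.

Let Ac_herm : Ac \is hermsymmx.
Proof.
apply: realsym_hermsym.
  apply/is_hermitianmxP; rewrite expr0 scale1r map_mx_id //.
  by rewrite map_trmx A_sym.
by apply/mxOverP => i j; rewrite mxE; apply/complex_realP; exists (A i j).
Qed.

Let AcE : Ac = P^t* *m diag_mx D *m P.
Proof.
rewrite -(invmx_unitary (spectral_unitarymx Ac)).
exact/orthomx_spectralP/hermitian_normalmx/Ac_herm.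
Qed.

Let d j : R := complex.Re (D 0 j).

Let dE j : D 0 j = f (d j).
Proof.
have /mxOverP/(_ 0 j)/complex_realP[k kE] := hermitian_spectral_diag_real Ac_herm.
by rewrite /d kE.
Qed.

Let eigen_row j : (row j P <= eigenspace Ac (f (d j)))%MS.
Proof.
apply/eigenspaceP; rewrite [X in _ *m X]AcE -row_mul !mulmxA.
rewrite (unitarymxP (spectral_unitarymx Ac)) mul1mx.
by apply/rowP => k; rewrite [LHS]mxE mul_diag_mx !mxE dE.
Qed.

Let rank_eigen a : \rank (eigenspace A a) = \rank (eigenspace Ac (f a)).
Proof.
by rewrite /eigenspace -map_scalar_mx -map_mxB -map_kermx mxrank_map.
Qed.

Let row_neq0 j : row j P != 0.
Proof.
apply/eqP => P0; have /row_unitarymxP/(_ j j) := spectral_unitarymx Ac.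
by rewrite P0 linear0l eqxx => /eqP; rewrite eq_sym oner_eq0.
Qed.

Let rank_gt0 j : (0 < \rank (eigenspace A (d j)))%N.
Proof.
rewrite rank_eigen lt0n mxrank_eq0; apply: contra_neq (row_neq0 j) => E0.
by apply/eqP; rewrite -submx0 -E0 eigen_row.
Qed.

(** Two distinct positive eigenvalues would contribute at least 1 each to the sum of the ranks; a
    repeated one has an eigenspace of rank at least 2. *)
Lemma one_pos_diag : at_most_one_pos_eigenvalue A ->
  forall i j, 0 < d i -> 0 < d j -> i = j.
Proof.
move=> A1 i j di dj; apply/eqP/negPn/negP => nij.
have [dij|ndij] := eqVneq (d i) (d j); last first.
  have := A1 [:: d i; d j]; rewrite /= inE ndij di dj => /(_ isT isT).
  by rewrite !big_cons big_nil; have := rank_gt0 i; have := rank_gt0 j; lia.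
have := A1 [:: d i]; rewrite /= di => /(_ isT isT).
rewrite big_cons big_nil addn0; apply/negP; rewrite -ltnNge rank_eigen.
(* Rows [i] and [j] of [P] form a unitary matrix with two rows, hence of rank 2, inside the
   eigenspace. *)
pose g (k : 'I_2) := if k == 0 then i else j.
pose M := rowsub g P.
have g_inj k l : (g k == g l) = (k == l).
  rewrite /g; case: k l => [[|[|//]] ?] [[|[|//]] ?]; rewrite /= ?eqxx //.
    by rewrite (negbTE nij).
  by rewrite eq_sym (negbTE nij).
have rE k : row k M = row (g k) P by apply/rowP => l; rewrite !mxE.
have uM : M \is unitarymx.
  apply/row_unitarymxP => k l; rewrite !rE.
  by have /row_unitarymxP -> := spectral_unitarymx Ac; rewrite g_inj.
rewrite -(mxrank_unitary uM); apply: mxrankS; apply/row_subP => k.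
rewrite rE /g; case: (k == 0); first exact: eigen_row.
by rewrite dij; exact: eigen_row.
Qed.

Let z (u : 'rV[C]_n) := u *m P^t*.
Let h (u v : 'rV[C]_n) := (u *m Ac *m v^t*) 0 0.

Let hE u v : h u v = \sum_j f (d j) * (z u 0 j * (z v 0 j)^*).
Proof.
rewrite /h AcE !mulmxA -(mulmxA _ P) -/(z u).
have -> : P *m v^t* = (z v)^t*.
  by rewrite /z trmx_mul map_mxM trmxCK.
rewrite mxE; apply: eq_bigr => j _.
rewrite mul_mx_diag !mxE dE -!mulrA; ring.
Qed.

(* The coefficient on the only positive eigenvector is killed by a complex
   combination [Y - s *: X] of the real vectors, on which the Hermitian form is
   nonpositive. *)
Lemma hyperbolic_of_one_pos : at_most_one_pos_eigenvalue A -> hyperbolic A.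
Proof.
move=> A1 x y qx.
pose X := map_mx f x; pose Y := map_mx f y.
have hf u v : h (map_mx f u) (map_mx f v) = f (bil A u v).
  rewrite /h (_ : (map_mx f v)^t* = map_mx f v^T); last first.
    apply/matrixP => i j; rewrite !mxE; apply/CrealP/complex_realP.
    by exists (v j i).
  by rewrite -!map_mxM mxE.
have hneg j0 u : (forall j, j != j0 -> d j <= 0) -> z u 0 j0 = 0 -> h u u <= 0.
  move=> dn z0; rewrite hE; apply: sumr_le0 => j _.
  have [->|nj] := eqVneq j j0; first by rewrite z0 mul0r mulr0.
  by rewrite mulr_le0_ge0 ?mul_conjC_ge0 // lecR dn.
have [j0 dj0] : exists j, 0 < d j.
  have [/existsP //|/existsPn dn] := boolP [exists j, 0 < d j].
  suff : h X X <= 0 by rewrite hf lecR leNgt qx.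
  rewrite hE; apply: sumr_le0 => j _.
  by rewrite mulr_le0_ge0 ?mul_conjC_ge0 // lecR leNgt dn.
have dn j : j != j0 -> d j <= 0.
  by move=> nj; rewrite leNgt; apply: contraNN nj => dj; apply/eqP/one_pos_diag.
have zx : z X 0 j0 != 0.
  by apply/eqP => z0; have := hneg _ _ dn z0; rewrite hf lecR leNgt qx.
pose s := z Y 0 j0 / z X 0 j0.
have zu : z (Y - s *: X) 0 j0 = 0.
  suff -> : z (Y - s *: X) 0 j0 = z Y 0 j0 - s * z X 0 j0.
    by rewrite divfK ?subrr.
  by rewrite /z mulmxBl -scalemxAl; move: (Y *m _) (X *m _) => a b; rewrite !mxE.
have := hneg _ _ dn zu.
have -> : h (Y - s *: X) (Y - s *: X) =
  h Y Y - s * h X Y - s^* * h Y X + s * s^* * h X X.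
  rewrite /h (_ : (Y - s *: X)^t* = Y^t* - s^* *: X^t*); last first.
    by apply/matrixP => i j; rewrite !mxE rmorphB rmorphM.
  rewrite !mulmxBl !mulmxBr -!scalemxAl -!scalemxAr.
  move: (Y *m Ac *m Y^t*) (X *m Ac *m Y^t*) (Y *m Ac *m X^t*) (X *m Ac *m X^t*).
  by move=> a b c e; rewrite !mxE; ring.
rewrite !hf (bilC y x A_sym).
case: s {zu} => a b; rewrite /f /=; simpc => /= /andP[_ le0].
move: (bil A x x) (bil A y y) (bil A x y) qx le0 => q r B q0 le0.
(* Multiplied by [q], the left side is [q * r - B ^+ 2 + (B - a * q) ^+ 2 + (b * q) ^+ 2]. *)
have := mulr_le0_ge0 le0 (ltW q0).
have := sqr_ge0 (B - a * q); have := sqr_ge0 (b * q); rewrite !expr2; lra.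
Qed.

End Spectral.

Section OnePos.
Variables (R : realType) (n : nat).
Implicit Types (A : 'M[R]_n) (u v x y : 'rV[R]_n).

Lemma bil1_gt0 u : u != 0 -> 0 < bil 1%:M u u.
Proof.
move=> u0; rewrite /bil mulmx1 mxE.
have u2 i : 0 <= u 0 i * u^T i 0 by rewrite mxE -expr2 sqr_ge0.
rewrite lt0r sumr_ge0 ?andbT //; apply: contra_neq u0 => s0.
apply/rowP => i; rewrite mxE; apply/eqP.
by have /psumr_eq0P/(_ i isT)/eqP := s0; rewrite mxE mulf_eq0 orbb; apply.
Qed.

Lemma bil_eigen A a u v : (u <= eigenspace A a)%MS ->
  bil A u v = a * bil 1%:M u v.
Proof. by move/eigenspaceP => uA; rewrite /bil uA mulmx1 -scalemxAl mxE. Qed.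

(** Two orthogonal nonzero eigenvectors with positive eigenvalues make the left side of the
    inequality positive and the right side 0. So a positive eigenspace is a line or zero, and since
    distinct eigenspaces are orthogonal, at most one of them is nonzero. *)
Lemma one_pos_of_hyperbolic A : A^T = A -> hyperbolic A ->
  at_most_one_pos_eigenvalue A.
Proof.
move=> As hA.
have orth a b u v : 0 < a -> 0 < b -> (u <= eigenspace A a)%MS ->
    (v <= eigenspace A b)%MS -> bil 1%:M u v = 0 -> u != 0 -> v = 0.
  move=> a0 b0 uA vA uv u0; apply/eqP/negPn/negP => v0.
  have := hA u v; rewrite !(bil_eigen _ uA) (bil_eigen _ vA) uv mulr0 expr0n /=.
  have := bil1_gt0 u0; have := bil1_gt0 v0 => pv pu /(_ (mulr_gt0 a0 pu)).
  by rewrite leNgt !mulr_gt0.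
have rk1 a : 0 < a -> (\rank (eigenspace A a) <= 1)%N.
  move=> a0; have [->|E0] := eqVneq (eigenspace A a) 0; first by rewrite mxrank0.
  set u := nz_row (eigenspace A a).
  have u0 : u != 0 by rewrite nz_row_eq0.
  have uA : (u <= eigenspace A a)%MS by exact: nz_row_sub.
  apply: leq_trans (rank_leq_row u); apply/mxrankS/row_subP => i.
  set v := row i _; have vA : (v <= eigenspace A a)%MS by exact: row_sub.
  pose c := bil 1%:M u v / bil 1%:M u u.
  have /(orth a a u (v - c *: u) a0 a0 uA) : bil 1%:M u (v - c *: u) = 0.
    by rewrite bilDr -scaleNr bilZr mulNr divfK ?subrr // gt_eqF ?bil1_gt0.
  rewrite addmx_sub ?eqmx_opp ?scalemx_sub // => /(_ isT u0) /subr0_eq ->.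
  exact: scalemx_sub.
have rk2 a b : 0 < a -> 0 < b -> a != b ->
    (\rank (eigenspace A a) == 0)%N || (\rank (eigenspace A b) == 0)%N.
  move=> a0 b0 nab; rewrite !mxrank_eq0.
  have [//|/= E0] := eqVneq (eigenspace A a) 0.
  set u := nz_row (eigenspace A a).
  have u0 : u != 0 by rewrite nz_row_eq0.
  have uA : (u <= eigenspace A a)%MS by exact: nz_row_sub.
  rewrite -submx0; apply/row_subP => i.
  set v := row i _; have vA : (v <= eigenspace A b)%MS by exact: row_sub.
  rewrite (orth a b u v) // ?sub0mx //.
  have := bilC u v As; rewrite (bil_eigen _ uA) (bil_eigen _ vA).
  rewrite (bilC v u (trmx1 _ _)) => /eqP; rewrite -subr_eq0 -mulrBl mulf_eq0.
  by rewrite subr_eq0 (negbTE nab) => /eqP.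
elim=> [|a s IHs] /=; first by rewrite big_nil.
move=> /andP[nas us] /andP[a0 s0]; rewrite big_cons.
have := rk1 a a0; have := IHs us s0.
have [-> _ _|ra _ _] := eqVneq (\rank (eigenspace A a)) 0%N.
  by rewrite add0n IHs.
rewrite big_seq big1 ?addn0 ?rk1 // => b bs.
have b0 : 0 < b by exact: (allP s0).
have nab : a != b by apply: contraNneq nas => ->.
by have := rk2 a b a0 b0 nab; rewrite (negbTE ra) => /eqP.
Qed.

End OnePos.

(** * Ultrametric matrices are positive semidefinite *)

Section Tropical.
Variables (R : realType) (n : nat).
Implicit Types (A : 'M[R]_n) (x y : 'rV[R]_n) (c : 'I_n -> 'I_n -> R).

(** A vector [x] of positive square lies off the hyperplane [l = 0], so [y] can be sheared along [x]
    into it; completing the square in the value there gives the inequality. *)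
Lemma hyperbolic_of_hyperplane A (l : 'rV[R]_n -> R) : A^T = A ->
  (forall x y (s : R), l (y - s *: x) = l y - s * l x) ->
  (forall x, l x = 0 -> bil A x x <= 0) -> hyperbolic A.
Proof.
move=> As ll lneg x y qx.
have lx : l x != 0 by apply/eqP => /lneg; rewrite leNgt qx.
have := lneg (y - (l y / l x) *: x); rewrite ll divfK // subrr => /(_ erefl).
set s := l y / l x; rewrite bilDl !bilDr -scaleNr !bilZr !bilZl.
rewrite (bilC y x As); move: (bil A x x) (bil A y y) (bil A x y) qx => q r B q0.
move=> /mulr_le0_ge0/(_ (ltW q0)).
by have := sqr_ge0 (B - s * q); rewrite !expr2; lra.
Qed.

(** The form is a sum of squares, one for each class of [e]. Reflexivity is not assumed: indices
    with [e k k] false contribute nothing. *)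
Lemma per_psd (e : rel 'I_n) (x : 'I_n -> R) :
  ssrbool.symmetric e -> transitive e ->
  0 <= \sum_k \sum_l (e k l)%:R * (x k * x l).
Proof.
move=> es et; pose rep k := [pick j | e k j].
have eE k l : e k l = [&& e k k, e l l & rep k == rep l].
  apply/idP/and3P => [ekl|[ekk ell /eqP]].
    have elk : e l k by rewrite es.
    rewrite (et _ _ _ ekl elk) (et _ _ _ elk ekl); split=> //; apply/eqP.
    apply: eq_pick => j; apply/idP/idP => [ekj|elj].
      exact: et ekj.
    exact: et elj.
  rewrite /rep; case: pickP => [j ekj|/(_ k)]; last by rewrite ekk.
  case: pickP => // j' elj' [jj']; rewrite -jj' in elj'.
  by apply: et ekj _; rewrite es.
suff -> : \sum_k \sum_l (e k l)%:R * (x k * x l) =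
    \sum_(r : option 'I_n) (\sum_(k | e k k && (rep k == r)) x k) ^+ 2.
  by apply: sumr_ge0 => r _; exact: sqr_ge0.
under [RHS]eq_bigr do rewrite expr2 big_distrlr /= big_mkcond /=.
rewrite [RHS]exchange_big; apply: eq_bigr => k _.
under [RHS]eq_bigr => r _ do rewrite big_mkcond /=.
case ekk: (e k k); last first.
  by rewrite !big1 // => l _; rewrite eE ekk mul0r.
rewrite (bigD1 (rep k)) //= eqxx [X in _ + X]big1 ?addr0; last first.
  by move=> r /negbTE; rewrite eq_sym => ->.
apply: eq_bigr => l _; rewrite eE ekk /= (eq_sym (rep l)).
by case: ifP => _; rewrite ?mul1r ?mul0r.
Qed.

(** Layers are peeled off: by the ultrametric inequality [0 < c k l] is a symmetric transitive
    relation, and subtracting the least positive value on it keeps the hypotheses while creating a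
    new zero. *)
Lemma ultrametric_psd c (x : 'I_n -> R) : (forall k l, c k l = c l k) ->
  (forall k l, 0 <= c k l) ->
  (forall j k l, Num.min (c j k) (c j l) <= c k l) ->
  0 <= \sum_k \sum_l c k l * (x k * x l).
Proof.
have [N] := ubnP #|[pred p : 'I_n * 'I_n | 0 < c p.1 p.2]|.
elim: N c => // N IHN c leN cs c0 cu.
case: (pickP [pred p : 'I_n * 'I_n | 0 < c p.1 p.2]) => [p0 /= p0c|c_eq0].
  pose p := [arg min_(p < p0 | 0 < c p.1 p.2) c p.1 p.2]%O.
  have [pc pmin] : 0 < c p.1 p.2 /\ forall k l, 0 < c k l -> c p.1 p.2 <= c k l.
    rewrite /p; case: arg_minP => // q qc qmin; split=> // k l kl.
    exact: (qmin (k, l)).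
  pose m := c p.1 p.2; rewrite -/m in pc pmin.
  pose e k l := 0 < c k l.
  have es : ssrbool.symmetric e by move=> k l; rewrite /e cs.
  have et : transitive e.
    move=> j k l; rewrite /e (cs k) => jk jl.
    by apply: lt_le_trans (cu j k l); rewrite lt_min jk.
  pose c' k l := c k l - m * (e k l)%:R.
  have c'0 k l : 0 <= c' k l.
    rewrite /c' /e; case: ltP => [/pmin|_]; last by rewrite mulr0 subr0.
    by rewrite mulr1 subr_ge0.
  have -> : \sum_k \sum_l c k l * (x k * x l) =
      \sum_k \sum_l c' k l * (x k * x l) +
      m * \sum_k \sum_l (e k l)%:R * (x k * x l).
    rewrite mulr_sumr -big_split; apply: eq_bigr => k _ /=.
    rewrite mulr_sumr -big_split; apply: eq_bigr => l _ /=.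
    by rewrite /c'; ring.
  rewrite addr_ge0 ?mulr_ge0 ?per_psd ?(ltW pc) //; apply: IHN => //.
  - apply: leq_trans (_ : #|[pred q : 'I_n * 'I_n | (0 < c q.1 q.2)%R]| <= N)%N.
      apply: proper_card; apply/properP; split.
        apply/fintype.subsetP => -[k l]; rewrite !inE /= /c' /e.
        by case kl: (0 < c k l) => //=; rewrite mulr0 subr0 kl.
      by exists p; rewrite !inE /= ?pc // /c' /e pc mulr1 subrr ltxx.
    by rewrite -ltnS.
  - by move=> k l; rewrite /c' (es k l) cs.
  - move=> j k l; have := cu j k l.
    have cN a b : ~~ e a b -> c a b = 0.
      by rewrite /e -leNgt => le0; apply/eqP; rewrite eq_le le0 c0.
    rewrite /c' !minElt; case jk: (e j k); case jl: (e j l).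
    + have -> : e k l by apply: et jl; rewrite es.
      by rewrite !mulr1 ltrD2r; case: ifP => _ h; rewrite lerD2r.
    + rewrite (cN j l) ?jl //= mulr0 subr0 => _.
      have := c'0 k l; have := c'0 j k; rewrite /c' jk.
      by case: ifP => //; lra.
    + rewrite (cN j k) ?jk //= mulr0 subr0 => _.
      have := c'0 k l; have := c'0 j l; rewrite /c' jl.
      by case: ifP => //; lra.
    + rewrite (cN j k) ?jk // (cN j l) ?jl //= mulr0 subr0 ltxx => _.
      exact: c'0.
rewrite big1 // => k _; rewrite big1 // => l _.
have /negbT := c_eq0 (k, l); rewrite /= -leNgt => le0.
by rewrite (_ : c k l = 0) ?mul0r //; apply/eqP; rewrite eq_le le0 c0.
Qed.

End Tropical.

(** * Tropical matrices *)

Section TropicalMatrix.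
Variables (R : realType) (n : nat).
Implicit Types (A : 'M[R]_n) (x y : 'rV[R]_n).

(** The four-point condition written multiplicatively, so that entries may vanish. Repeated indices
    are included; [i = j] bounds the diagonal entries. *)
Definition tropical A : Prop := forall i j k l,
  A i j * A k l <= Num.max (A i k * A j l) (A i l * A j k).

(* After scaling the row [o] to a constant, [A] is a constant minus an
   ultrametric similarity matrix, which is positive semidefinite. *)
Lemma hyperbolic_pos A (o : 'I_n) : A^T = A -> (forall i j, 0 < A i j) ->
  tropical A -> hyperbolic A.
Proof.
move=> As A0 tA.
have sA i j : A i j = A j i by rewrite -[in LHS]As mxE.
pose b k l := A k l / (A o k * A o l).
have bE k l : A k l = b k l * (A o k * A o l).
  by rewrite divfK // mulf_neq0 ?gt_eqF ?A0.
pose M := (A o o)^-1.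
have M0 : 0 < M by rewrite invr_gt0.
have bM k l : b k l <= M.
  have := tA o o k l; rewrite maxC (mulrC (A o l)) maxxx => h.
  rewrite /b ler_pdivrMr ?mulr_gt0 ?A0 // /M mulrC ler_pdivlMr ?A0 //.
  by rewrite mulrC.
have bu j k l : b k l <= Num.max (b j k) (b j l).
  have := tA o j k l; rewrite (bE k l) (bE j l) (bE j k).
  have -> : A o k * (b j l * (A o j * A o l)) =
    b j l * (A o j * (A o k * A o l)) by ring.
  have -> : A o l * (b j k * (A o j * A o k)) =
    b j k * (A o j * (A o k * A o l)) by ring.
  rewrite mulrCA -maxr_pMl ?ler_pM2r ?mulr_gt0 ?A0 //; first by rewrite maxC.
  by rewrite ltW ?mulr_gt0 ?A0.
apply: (@hyperbolic_of_hyperplane _ _ _ (fun x => \sum_k A o k * x 0 k)) => //.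
  move=> x y s; rewrite mulr_sumr -sumrB; apply: eq_bigr => k _.
  by rewrite !mxE; ring.
move=> x Y0; rewrite bilE.
pose y k := A o k * x 0 k.
have -> : \sum_i \sum_j x 0 i * A i j * x 0 j =
    M * (\sum_k y k) ^+ 2 - \sum_i \sum_j (M - b i j) * (y i * y j).
  rewrite expr2 big_distrlr /= mulr_sumr -sumrB; apply: eq_bigr => i _.
  rewrite mulr_sumr -sumrB; apply: eq_bigr => j _.
  by rewrite (bE i j) /y; ring.
rewrite Y0 expr0n /= mulr0 sub0r oppr_le0; apply: ultrametric_psd.
- by move=> k l; rewrite /b sA (mulrC (A o k)).
- by move=> k l; rewrite subr_ge0.
- move=> j k l; have := bu j k l; rewrite le_max ge_min !lerD2l !lerN2.
  by rewrite orbC => /orP[] ->; rewrite ?orbT.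
Qed.

Lemma le_of_le_eps (x K : R) : (forall e, 0 < e -> e <= 1 -> x <= e * K) ->
  x <= 0.
Proof.
move=> h; rewrite leNgt; apply/negP => x0.
have K0 : 0 < K by have := h 1 ltr01 (lexx _); lra.
have KK : 0 < K + K + x by lra.
have := h (x / (K + K + x)); rewrite divr_gt0 // ler_pdivrMr // mul1r.
have -> : x <= K + K + x by lra.
move=> /(_ isT isT); rewrite mulrAC ler_pdivlMr //; nra.
Qed.

(* [F k l] is the largest [A i j], discounted by [e] for every index moved:
   this keeps the four-point condition and removes the zero entries. *)
Lemma tropical_approx A (e : R) : A^T = A -> (forall i j, 0 <= A i j) ->
  tropical A -> (exists i j, 0 < A i j) -> 0 < e -> e <= 1 ->
  exists F : 'M[R]_n, [/\ F^T = F, forall i j, 0 < F i j, tropical F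
    & forall k l, A k l <= F k l <= A k l + e * \sum_i \sum_j A i j].
Proof.
move=> As A0 tA [p [q Apq]] e0 e1.
have sA i j : A i j = A j i by rewrite -[in LHS]As mxE.
pose d (k i : 'I_n) : R := if k == i then 1 else e.
have d0 k i : 0 < d k i by rewrite /d; case: ifP.
have d1 k i : d k i <= 1 by rewrite /d; case: ifP.
pose G k l (ij : 'I_n * 'I_n) := d k ij.1 * A ij.1 ij.2 * d l ij.2.
pose am k l := [arg max_(ij > (k, l)) G k l ij]%O.
have GM k l ij : G k l ij <= G k l (am k l).
  by rewrite /am; case: arg_maxP => // m _; apply.
pose F := \matrix_(k, l) G k l (am k l).
have FE k l : F k l = G k l (am k l) by rewrite mxE.
have sG k l i j : G k l (i, j) = G l k (j, i).
  by rewrite /G /= (sA i j); ring.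
have sF k l : F k l <= F l k.
  by rewrite !FE; case: (am k l) => i j; rewrite sG.
exists F; split.
- by apply/matrixP => k l; rewrite mxE; apply/eqP; rewrite eq_le !sF.
- move=> k l; rewrite FE; apply: lt_le_trans (GM k l (p, q)).
  by rewrite /G /= !mulr_gt0.
- move=> i j k l; rewrite !FE.
  case: (am i j) (am k l) => [i' j'] [k' l'].
  set D := d i i' * d j j' * d k k' * d l l'.
  have D0 : 0 < D by rewrite !mulr_gt0.
  (* The discount [D] depends only on how the four indices move, not on how they are paired, so the
     condition on [A] at the maximisers transfers to [F]. *)
  have -> : G i j (i', j') * G k l (k', l') = D * (A i' j' * A k' l').
    by rewrite /G /D /=; ring.
  have G0 a b ij : 0 <= G a b ij by rewrite /G !mulr_ge0 // ltW.
  rewrite le_max; have := tA i' j' k' l'; rewrite le_max => /orP[] h.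
    apply/orP; left; apply: le_trans (_ : G i k (i', k') * G j l (j', l') <= _).
      have -> : G i k (i', k') * G j l (j', l') = D * (A i' k' * A j' l').
        by rewrite /G /D /=; ring.
      by rewrite ler_pM2l.
    by rewrite ler_pM.
  apply/orP; right; apply: le_trans (_ : G i l (i', l') * G j k (j', k') <= _).
    have -> : G i l (i', l') * G j k (j', k') = D * (A i' l' * A j' k').
      by rewrite /G /D /=; ring.
    by rewrite ler_pM2l.
  by rewrite ler_pM.
- move=> k l; rewrite FE; apply/andP; split.
    by apply: le_trans (GM k l (k, l)); rewrite /G /d /= !eqxx mul1r mulr1.
  case: (am k l) => i j; rewrite /G /=.
  have S0 : 0 <= \sum_i \sum_j A i j.
    by apply: sumr_ge0 => ? _; apply: sumr_ge0.
  have key : e * A i j <= A k l + e * \sum_i \sum_j A i j.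
    apply: le_trans (_ : e * \sum_i \sum_j A i j <= _); last by rewrite lerDr.
    rewrite ler_pM2l // (bigD1 i) //= (bigD1 j) //= -addrA lerDl.
    by apply: addr_ge0; [|apply: sumr_ge0 => ? _]; apply: sumr_ge0.
  have Aij e' : 0 <= e' -> e' <= 1 -> e * e' * A i j <= e * A i j.
    by move=> e'0 e'1; rewrite ler_wpM2r // ler_piMr // ltW.
  rewrite /d; case: (eqVneq k i) => [ki|_]; case: (eqVneq l j) => [lj|_].
  - by rewrite ki lj mul1r mulr1 lerDl mulr_ge0 // ltW.
  - by rewrite mul1r mulrC.
  - by rewrite mulr1.
  - by apply: le_trans key; rewrite mulrAC Aij // ltW.
Qed.

(** The positive case passes to the limit [e -> 0], because the hypothesis [0 < bil A x x] is an
    open condition. *)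
Lemma hyperbolic_tropical A : A^T = A -> (forall i j, 0 <= A i j) ->
  tropical A -> hyperbolic A.
Proof.
move=> As A0 tA x y qx.
have [o Ao] : exists i j, 0 < A i j.
  apply: contrapT => nA; move: qx; rewrite bilE big1 ?ltxx // => i _.
  rewrite big1 // => j _; have -> : A i j = 0; last by rewrite mulr0 mul0r.
  apply/eqP; rewrite eq_le A0 andbT leNgt; apply/negP => Aij.
  by apply: nA; exists i, j.
pose S := \sum_i \sum_j A i j.
have S0 : 0 <= S by apply: sumr_ge0 => ? _; apply: sumr_ge0.
pose V : R := \sum_i (`|x 0 i| + `|y 0 i|).
pose K : R := V * V * S.
have V0 : 0 <= V by apply: sumr_ge0 => i _; rewrite addr_ge0.
have K0 : 0 <= K by rewrite !mulr_ge0.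
have close e (F : 'M[R]_n) (u v : 'rV[R]_n) : 0 < e ->
    (forall i, `|u 0 i| <= `|x 0 i| + `|y 0 i|) ->
    (forall i, `|v 0 i| <= `|x 0 i| + `|y 0 i|) ->
    (forall k l, A k l <= F k l <= A k l + e * S) ->
    `|bil F u v - bil A u v| <= e * K.
  move=> e0 hu hv hF; rewrite !bilE -sumrB.
  apply: le_trans (ler_norm_sum _ _ _) _.
  rewrite /K mulrCA -mulrA mulr_suml; apply: ler_sum => i _.
  rewrite -sumrB; apply: le_trans (ler_norm_sum _ _ _) _.
  rewrite mulr_suml mulr_sumr; apply: ler_sum => j _.
  rewrite -mulrBl -mulrBr !normrM -mulrA ler_pM ?mulr_ge0 //.
  rewrite mulrC ler_pM //.
  by have /andP[? ?] := hF i j; rewrite ger0_norm ?subr_ge0 // lerBlDl.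
(* The first summand bounds the change of the discriminant when [bil F x x] is positive. Otherwise
   [bil A x x <= e * K], and the second summand suffices. *)
pose L := K * (`|bil A x x| + `|bil A y y| + 2 * `|bil A x y| + 2 * K) +
  K * (bil A x x * bil A y y - bil A x y ^+ 2) / bil A x x.
have [//|g0] := leP (bil A x x * bil A y y) (bil A x y ^+ 2).
suff : bil A x x * bil A y y - bil A x y ^+ 2 <= 0 by rewrite leNgt subr_gt0 g0.
apply: (@le_of_le_eps _ L) => e e0 e1.
have [F [sF F0 tF hF]] := tropical_approx As A0 tA (ex_intro _ o Ao) e0 e1.
have hx i : `|x 0 i| <= `|x 0 i| + `|y 0 i| by rewrite lerDl.
have hy i : `|y 0 i| <= `|x 0 i| + `|y 0 i| by rewrite lerDr.
have := close _ _ _ _ e0 hx hx hF; have := close _ _ _ _ e0 hy hy hF.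
have := close _ _ _ _ e0 hx hy hF.
have hypF : hyperbolic F by exact: hyperbolic_pos.
have := hypF x y.
rewrite /L; move: (bil F x x) (bil F y y) (bil F x y) (bil A x x) (bil A y y)
  (bil A x y) qx g0 => q' r' B' q r B q0 g0 h.
rewrite !ler_norml => /andP[B1 B2] /andP[r1 r2] /andP[q1 q2].
set g := q * r - B ^+ 2; have {}g0 : 0 < g by rewrite subr_gt0.
set L1 := K * _; rewrite mulrDr.
have eK : 0 <= e * K by rewrite mulr_ge0 // ltW.
have L10 : 0 <= e * L1.
  by rewrite mulr_ge0 ?(ltW e0) // /L1 mulr_ge0 // !addr_ge0 // mulr_ge0.
have L20 : 0 <= e * (K * g / q) by rewrite !mulr_ge0 ?invr_ge0 // ltW.
have [q'0|q'0] := leP q' 0.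
  have : g * q <= g * (e * K) by rewrite ler_pM2l //; lra.
  have -> : e * (K * g / q) = g * (e * K) / q by ring.
  rewrite -ler_pdivlMr // => h1; apply: le_trans h1 _; rewrite lerDr //.
apply: le_trans (_ : e * L1 <= _); last by rewrite lerDl.
have {}h := h q'0; rewrite /L1 mulrA.
have EK : e * K <= K by rewrite ler_piMl.
set E := e * K in eK EK B1 B2 r1 r2 q1 q2 *.
have hm (a b c : R) : - E <= b <= E -> `|a| <= c -> a * b <= c * E.
  move=> bE ac; apply: le_trans (ler_norm _) _.
  by rewrite normrM ler_pM // ler_norml.
have := hm q (r - r') `|q|; rewrite lexx => /(_ _ isT) h1.
have := hm r' (q - q') (`|r| + K) => h2.
have := hm (B' + B) (B' - B) (2 * `|B| + K) => h3.
have := ler_norm r; have := ler_norm (- r); rewrite normrN => r3 r4.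
have := ler_norm B; have := ler_norm (- B); rewrite normrN => B3 B4.
have {}h1 : q * (r - r') <= `|q| * E by apply: h1; lra.
have {}h2 : r' * (q - q') <= (`|r| + K) * E.
  by apply: h2; [lra | rewrite ler_norml; lra].
have {}h3 : (B' + B) * (B' - B) <= (2 * `|B| + K) * E.
  by apply: h3; [lra | rewrite ler_norml; lra].
rewrite /g; lra.
Qed.

End TropicalMatrix.

(** * Bounded ratios and tropical functions *)

Section Multinomials.
Variable n : nat.
Implicit Types (a b g : multinom n) (i j k l : 'I_n).

Definition sh b i j : multinom n := (b + 'e_i + 'e_j)%mnm.

Lemma shC b i j : sh b i j = sh b j i.
Proof. by apply/mnmP => k; rewrite !mnmDE addnAC. Qed.

Lemma shE b i j k : sh b i j k = (b k + (i == k) + (j == k))%N.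
Proof. by rewrite !mnmDE !mnm1E. Qed.

Lemma mdeg_sh b i j : mdeg (sh b i j) = (mdeg b + 2)%N.
Proof. by rewrite !mdegD !mdeg1 -addnA. Qed.

Lemma in_Delta d a : (a \in Delta n d) = (mdeg a == d).
Proof.
apply/imfsetP/idP => [[m /=]|/eqP ad]; first by move=> md ->.
have lt : (mdeg a < d.+1)%N by rewrite ad.
by exists (BMultinom lt); rewrite ?inE //= ad.
Qed.

End Multinomials.

Section Pairing.
Variables (R : realType) (n : nat).
Implicit Types (S : {fset multinom n}) (f : mpoly n R) (nu mu : multinom n -> R).

Definition pair S (w : {ffun S -> R^o}) nu : R := \sum_(x : S) w x * nu (val x).

(* The sign makes tropical functions min-plus, as for M-convex functions. *)
Definition logc f (a : multinom n) : R := - ln (ncoeff f a).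

Lemma pairDl S (w v : {ffun S -> R^o}) nu :
  pair (w + v) nu = pair w nu + pair v nu.
Proof.
by rewrite /pair -big_split; apply: eq_bigr => x _; rewrite ffunE mulrDl.
Qed.

Lemma pairZl S (c : R) (w : {ffun S -> R^o}) nu : pair (c *: w) nu = c * pair w nu.
Proof.
by rewrite /pair mulr_sumr; apply: eq_bigr => x _; rewrite ffunE -mulrA.
Qed.

Lemma pair0l S nu : pair (0 : {ffun S -> R^o}) nu = 0.
Proof. by rewrite /pair big1 // => x _; rewrite ffunE mul0r. Qed.

Lemma pairNl S (w : {ffun S -> R^o}) nu : pair (- w) nu = - pair w nu.
Proof. by rewrite -scaleN1r pairZl mulN1r. Qed.

Lemma pair_suml S (I : Type) (r : seq I) (P : pred I)
    (F : I -> {ffun S -> R^o}) nu :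
  pair (\sum_(i <- r | P i) F i) nu = \sum_(i <- r | P i) pair (F i) nu.
Proof.
elim/big_rec2: _ => [|i x y _ <-]; first exact: pair0l.
by rewrite pairDl.
Qed.

Lemma pairDr S (w : {ffun S -> R^o}) nu mu :
  pair w (fun a => nu a + mu a) = pair w nu + pair w mu.
Proof. by rewrite /pair -big_split; apply: eq_bigr => x _; rewrite mulrDr. Qed.

Lemma pairZr S (w : {ffun S -> R^o}) (c : R) nu :
  pair w (fun a => c * nu a) = c * pair w nu.
Proof. by rewrite /pair mulr_sumr; apply: eq_bigr => x _; rewrite mulrCA. Qed.

Lemma eq_pair S (w : {ffun S -> R^o}) nu mu : (forall a, a \in S -> nu a = mu a) ->
  pair w nu = pair w mu.
Proof. by move=> e; apply: eq_bigr => x _; rewrite e ?fsvalP. Qed.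

Lemma pair_eps S a nu : a \in S -> pair (eps R S a) nu = nu a.
Proof.
move=> aS; rewrite /pair (bigD1 [` aS]) //= ffunE /= eqxx mul1r big1 ?addr0 //.
move=> x xa; rewrite ffunE (_ : val x == a = false) ?mul0r //.
by apply: contraNF xa => /eqP xa; apply/eqP/val_inj.
Qed.

Lemma Rmon_expR d S (w : {ffun S -> R^o}) f : Lplus d S f ->
  Rmon w f = expR (- pair w (logc f)).
Proof.
case=> _ fS; rewrite /pair -sumrN expR_sum; apply: eq_bigr => x _.
rewrite /powR gt_eqF; last by apply/fS; exact: fsvalP.
by rewrite /logc mulrN opprK.
Qed.

Lemma BR_lower d S (w : {ffun S -> R^o}) :
  BR R d S w <-> exists C, forall f, Lplus d S f -> - C <= pair w (logc f).
Proof.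
split=> [[M MP]|[C CP]].
  (* The bound [1 + x <= expR x] avoids the logarithm of [M], whose sign is unknown. *)
  exists (M - 1) => f fL; have /MP : [set Rmon w f | f in Lplus d S]%classic (Rmon w f).
    by exists f.
  rewrite (Rmon_expR _ fL) => h; have := expR_ge1Dx (- pair w (logc f)); lra.
exists (expR C) => _ [f fL <-]; rewrite (Rmon_expR _ fL) ler_expR.
have := CP f fL; lra.
Qed.

Lemma BRD d S (w v : {ffun S -> R^o}) : BR R d S w -> BR R d S v ->
  BR R d S (w + v).
Proof.
move=> /BR_lower[C CP] /BR_lower[D DP]; apply/BR_lower; exists (C + D) => f fL.
by rewrite pairDl; have := CP f fL; have := DP f fL; lra.
Qed.

Lemma BRZ d S (c : R) (w : {ffun S -> R^o}) : 0 <= c -> BR R d S w ->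
  BR R d S (c *: w).
Proof.
move=> c0 /BR_lower[C CP]; apply/BR_lower; exists (c * C) => f fL.
by rewrite pairZl -mulrN ler_wpM2l // CP.
Qed.

Lemma BR0 d S : BR R d S 0.
Proof. by apply/BR_lower; exists 0 => f _; rewrite pair0l oppr0. Qed.

Lemma Cone_sub_BR d S (E : set {ffun S -> R^o}) : (E `<=` BR R d S)%classic ->
  (Cone E `<=` BR R d S)%classic.
Proof.
move=> EB _ [k [u [c [uE c0 ->]]]].
elim/big_ind: _ => [|v w|i _]; [exact: BR0 | exact: BRD |].
by apply: BRZ => //; apply: EB.
Qed.

Lemma Cone_incl (V : lmodType R) (E : set V) x : E x -> Cone E x.
Proof.
move=> Ex; exists 1%N, (fun=> x), (fun=> 1); split=> //.
by rewrite big_ord1 scale1r.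
Qed.

Lemma ConeD (V : lmodType R) (E : set V) x y : Cone E x -> Cone E y ->
  Cone E (x + y).
Proof.
move=> [k [u [c [uE c0 ->]]]] [k' [u' [c' [uE' c0' ->]]]].
exists (k + k')%N, (fun i => match split i with inl j => u j | inr j => u' j end),
  (fun i => match split i with inl j => c j | inr j => c' j end).
split=> [i|i|]; rewrite ?big_split_ord /=; [by case: split|by case: split|].
congr (_ + _); apply: eq_bigr => i _.
  case: splitP => j /= e; first by congr (c _ *: u _); apply: val_inj.
  by have := ltn_ord i; lia.
case: splitP => j /= e; first by have := ltn_ord j; lia.
have -> : i = j by apply: val_inj => /=; lia.
by [].
Qed.

Lemma Cone0 (V : lmodType R) (E : set V) : Cone E 0.
Proof. by exists 0%N, (fun=> 0), (fun=> 0); split=> [[]|[]|] //; rewrite big_ord0. Qed.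

Lemma ConeZ (V : lmodType R) (E : set V) (a : R) x : 0 <= a -> Cone E x ->
  Cone E (a *: x).
Proof.
move=> a0 [k [u [c [uE c0 ->]]]]; exists k, u, (fun i => a * c i); split=> //.
  by move=> i; rewrite mulr_ge0.
by rewrite scaler_sumr; apply: eq_bigr => i _; rewrite scalerA.
Qed.

End Pairing.

Section Generating.
Variables (R : realType) (n : nat).
Implicit Types (S : {fset multinom n}) (nu : multinom n -> R).

Definition mpoly_of S nu : mpoly n R :=
  \sum_(a <- S) (expR (- nu a) / (\prod_(i < n) (a i)`!)%:R) *: mpolyX R a.

Lemma ncoeff_mpoly_of S nu a :
  ncoeff (mpoly_of S nu) a = if a \in S then expR (- nu a) else 0.
Proof.
have fact0 b : (\prod_(i < n) (b i)`!)%:R != 0 :> R.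
  by rewrite pnatr_eq0 -lt0n prodn_gt0 // => i; rewrite fact_gt0.
rewrite /ncoeff /mpoly_of raddf_sum /=.
under [X in _ * X]eq_bigr do rewrite mcoeffZ mcoeffX.
case: ifP => aS; last first.
  rewrite [X in _ * X]big_seq [X in _ * X]big1 ?mulr0 // => b bS.
  by case: eqP aS => [<-|_ _]; rewrite ?bS ?mulr0.
rewrite (big_fsetD1 a) //= eqxx mulr1 [X in _ + X]big_seq.
rewrite [X in _ + X]big1 ?addr0; last first.
  by move=> b; rewrite !inE => /andP[/negbTE -> _]; rewrite mulr0.
by rewrite mulrC divfK.
Qed.

(* Repeated indices are allowed: they give the inequalities on the diagonal
   entries, and membership in [S] gives the M-convexity of the support. *)
Definition trop S nu : Prop := forall b i j k l,
  sh b i j \in S -> sh b k l \in S ->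
  [/\ sh b i k \in S, sh b j l \in S
    & nu (sh b i k) + nu (sh b j l) <= nu (sh b i j) + nu (sh b k l)] \/
  [/\ sh b i l \in S, sh b j k \in S
    & nu (sh b i l) + nu (sh b j k) <= nu (sh b i j) + nu (sh b k l)].

Lemma hess_sym (f : mpoly n R) b : (hess f b)^T = hess f b.
Proof. by apply/matrixP => i j; rewrite !mxE; congr ncoeff; exact: shC. Qed.

(** Homogeneity, signs and support are automatic for [mpoly_of]. This serves twice: for tropical
    [nu], and for the derivatives of a Lorentzian polynomial. *)
Lemma Lplus_mpoly_of_hess d S nu : Mconvex d S ->
  (forall b, (mdeg b + 2)%N = d ->
    at_most_one_pos_eigenvalue (hess (mpoly_of S nu) b)) ->
  Lplus d S (mpoly_of S nu).
Proof.
move=> SM hS; have [S0 SD _] := SM.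
have c0 a : a \in S -> 0 < ncoeff (mpoly_of S nu) a.
  by rewrite ncoeff_mpoly_of => ->; exact: expR_gt0.
have cS a : 0 < ncoeff (mpoly_of S nu) a <-> a \in S.
  split=> [|/c0 //]; rewrite ncoeff_mpoly_of; case: ifP => //; by rewrite ltxx.
split=> //; split=> //.
- rewrite /mpoly_of big_seq; apply: rpred_sum => a aS; apply: rpredZ.
  by rewrite dhomogX -in_Delta (fsubsetP SD).
- apply: contraNneq S0 => f0; apply/eqP/fsetP => a; rewrite inE.
  by apply/negP => /c0; rewrite f0 /ncoeff mcoeff0 mulr0 ltxx.
- move=> a; rewrite ncoeff_mpoly_of; case: ifP => // _; exact: expR_ge0.
- suff -> : [fset a in Delta n d | ncoeff (mpoly_of S nu) a != 0] = S by [].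
  apply/fsetP => a; rewrite !inE ncoeff_mpoly_of.
  case: ifP => aS; last by rewrite eqxx andbF.
  by rewrite gt_eqF ?expR_gt0 ?andbT // (fsubsetP SD).
Qed.

Lemma Lplus_mpoly_of d S nu : Mconvex d S -> trop S nu ->
  Lplus d S (mpoly_of S nu).
Proof.
move=> SM tS; apply: Lplus_mpoly_of_hess => // b _.
apply: one_pos_of_hyperbolic; first exact: hess_sym.
have hE i j : hess (mpoly_of S nu) b i j =
    if sh b i j \in S then expR (- nu (sh b i j)) else 0.
  by rewrite mxE ncoeff_mpoly_of.
have h0 i j : 0 <= hess (mpoly_of S nu) b i j.
  by rewrite hE; case: ifP => // _; exact: expR_ge0.
apply: hyperbolic_tropical => //; first exact: hess_sym.
move=> i j k l; rewrite (hE i j) (hE k l).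
case: ifP => ij; last by rewrite mul0r le_max mulr_ge0.
case: ifP => kl; last by rewrite mulr0 le_max mulr_ge0.
rewrite le_max -expRD; apply/orP.
by have [[a1 a2 le]|[a1 a2 le]] := tS b i j k l ij kl; [left|right];
  rewrite !hE a1 a2 -expRD ler_expR; lra.
Qed.

Lemma tropZ S nu (t : R) : 0 <= t -> trop S nu -> trop S (fun a => t * nu a).
Proof.
move=> t0 tS b i j k l ij kl.
have [[a1 a2 le]|[a1 a2 le]] := tS b i j k l ij kl; [left|right];
  by split=> //; rewrite -!mulrDr ler_wpM2l.
Qed.

Lemma BR_trop d S (w : {ffun S -> R^o}) nu : Mconvex d S -> BR R d S w ->
  trop S nu -> 0 <= pair w nu.
Proof.
move=> SM /BR_lower[C CP] tS; rewrite leNgt; apply/negP => p0.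
have {}CP t : 0 <= t -> - C <= t * pair w nu.
  move=> t0; apply: le_trans (CP _ (Lplus_mpoly_of SM (tropZ t0 tS))) _.
  rewrite -pairZr (@eq_pair _ _ _ _ _ (fun a => t * nu a)) // => a aS.
  by rewrite /logc ncoeff_mpoly_of aS expRK opprK.
(* At this [t] the functional equals [- (|C| + 1)], below the bound. *)
have := CP ((`|C| + 1) / - pair w nu).
rewrite divr_ge0 ?addr_ge0 ?oppr_ge0 ?(ltW p0) // => /(_ isT).
rewrite invrN mulrN mulNr divfK ?lt_eqF //.
by have := ler_norm C; lra.
Qed.

End Generating.

(** * Derivatives and the four-point inequality for Lorentzian polynomials *)

Section Local.
Variables (R : realType) (n : nat).
Implicit Types (S : {fset multinom n}) (nu : multinom n -> R) (b g : multinom n).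

Lemma pair_delta S (w : {ffun S -> R^o}) (x : S) (c : R) :
  pair w (fun a => c * (a == val x)%:R) = c * w x.
Proof.
rewrite pairZr; congr (_ * _); rewrite /pair (bigD1 x) //= eqxx mulr1.
rewrite big1 ?addr0 // => y /negbTE yx.
by rewrite (_ : fsval y == fsval x = false) ?mulr0 // -yx -val_eqE.
Qed.

Lemma pair_inj S (w v : {ffun S -> R^o}) :
  (forall nu, pair w nu = pair v nu) -> w = v.
Proof.
move=> e; apply/ffunP => x; have := e (fun a => 1 * (a == val x)%:R).
by rewrite !pair_delta !mul1r.
Qed.

Lemma mdegSP m g : mdeg g = m.+1 ->
  exists i h, g = (h + 'e_i)%mnm /\ mdeg h = m.
Proof.
move=> gm; have [i gi] : exists i, (0 < g i)%N.
  apply/existsP; apply: contraT => /existsPn g0.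
  move: gm; rewrite mdegE big1 // => i _.
  by apply/eqP; rewrite -leqn0 leqNgt.
have ge : g = ((g - 'e_i) + 'e_i)%mnm.
  apply/mnmP => k; rewrite mnmDE mnmBE mnm1E.
  by case: eqP => [<-|_]; lia.
exists i, (g - 'e_i)%mnm; split=> //.
by move: gm; rewrite {1}ge mdegD mdeg1 addn1 => -[].
Qed.

Lemma mdeg2P g : mdeg g = 2%N -> exists i j, g = sh mnm0 i j.
Proof.
move=> /mdegSP[j [h [-> /mdegSP[i [z [-> /eqP]]]]]].
by rewrite mdeg_eq0 => /eqP ->; exists i, j.
Qed.

Lemma in_Sloc S b g : (g \in Sloc S b) = (mdeg g == 2%N) && ((b + g)%mnm \in S).
Proof.
rewrite !inE; congr (_ && _); apply/imfset2P/idP.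
  by case=> i _ [j _ ->]; rewrite mdegD !mdeg1.
move/eqP/mdeg2P => [i [j ->]]; exists i => //; exists j => //.
by rewrite /sh add0m.
Qed.

Lemma sh_add b i j : (b + sh mnm0 i j)%mnm = sh b i j.
Proof. by rewrite /sh add0m addmA. Qed.

Lemma sh_Sloc S b i j : (sh mnm0 i j \in Sloc S b) = (sh b i j \in S).
Proof. by rewrite in_Sloc mdeg_sh mdeg0 sh_add. Qed.

Lemma Mconvex_Sloc d S b : Mconvex d S -> Sloc S b != fset0 ->
  Mconvex 2 (Sloc S b).
Proof.
move=> [S0 SD SX] T0; split=> //.
  by apply/fsubsetP => g; rewrite in_Sloc in_Delta => /andP[].
move=> g h i; rewrite !in_Sloc => /andP[/eqP g2 gS] /andP[/eqP h2 hS] hgi.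
have lt : ((b + h)%mnm i < (b + g)%mnm i)%N by rewrite !mnmDE ltn_add2l.
have [j [hj S1 S2]] := SX _ _ i gS hS lt.
rewrite !mnmDE ltn_add2l in hj; exists j; split=> //; rewrite in_Sloc.
  have -> : (b + (g - 'e_i + 'e_j))%mnm = (b + g - 'e_i + 'e_j)%mnm.
    apply/mnmP => k; rewrite !mnmDE !mnmBE !mnmDE !mnm1E.
    by case: (eqVneq i k) => [<-|_]; lia.
  rewrite S1 andbT -(eqn_add2r (mdeg (mnm1 i))) -mdegD.
  have -> : (g - 'e_i + 'e_j + 'e_i)%mnm = (g + 'e_j)%mnm.
    apply/mnmP => k; rewrite !mnmDE !mnmBE !mnm1E.
    by case: (eqVneq i k) => [<-|_]; lia.
  by rewrite mdegD g2 !mdeg1.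
have -> : (b + (h - 'e_j + 'e_i))%mnm = (b + h - 'e_j + 'e_i)%mnm.
  apply/mnmP => k; rewrite !mnmDE !mnmBE !mnmDE !mnm1E.
  by case: (eqVneq j k) => [<-|_]; lia.
rewrite S2 andbT -(eqn_add2r (mdeg (mnm1 j))) -mdegD.
have -> : (h - 'e_j + 'e_i + 'e_j)%mnm = (h + 'e_i)%mnm.
  apply/mnmP => k; rewrite !mnmDE !mnmBE !mnm1E.
  by case: (eqVneq j k) => [<-|_]; lia.
by rewrite mdegD h2 !mdeg1.
Qed.

Lemma pair_lift_loc S b (v : {ffun Sloc S b -> R^o}) nu :
  pair (lift_loc v) nu = pair v (fun g => nu (b + g)%mnm).
Proof.
rewrite pair_suml; apply: eq_bigr => g _; rewrite pairZl pair_eps //.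
by have := fsvalP g; rewrite in_Sloc => /andP[].
Qed.

Lemma ncoeff_notin d S (f : mpoly n R) a : Lplus d S f -> a \notin S ->
  ncoeff f a = 0.
Proof.
move=> [[_ _ c0 _ _] cS] aS; apply/eqP; rewrite eq_le c0 andbT leNgt.
by apply: contraNN aS => /cS.
Qed.

Lemma ncoeff_logc d S (f : mpoly n R) a : Lplus d S f -> a \in S ->
  ncoeff f a = expR (- logc f a).
Proof. by move=> [_ cS] /cS c0; rewrite /logc opprK lnK. Qed.

(** This polynomial is the derivative of [f] along [b], whose normalized coefficients are those of
    [f] shifted by [b]; its only Hessian, at 0, is [hess f b]. *)
Lemma Lplus_deriv d S (f : mpoly n R) b : Mconvex d S -> (mdeg b + 2)%N = d ->
  Sloc S b != fset0 -> Lplus d S f ->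
  Lplus 2 (Sloc S b) (mpoly_of (Sloc S b) (fun g => logc f (b + g)%mnm)).
Proof.
move=> SM bd T0 fL; apply: Lplus_mpoly_of_hess; first exact: Mconvex_Sloc SM T0.
move=> b0 /eqP; rewrite -[X in _ == X]add0n eqn_add2r mdeg_eq0 => /eqP ->.
suff -> : hess (mpoly_of (Sloc S b) (fun g => logc f (b + g)%mnm)) mnm0 = hess f b.
  by have [[_ _ _ _ +] _] := fL; apply.
apply/matrixP => i j; rewrite !mxE -[(mnm0 + _ + _)%mnm]/(sh mnm0 i j).
rewrite -[(b + _ + _)%mnm]/(sh b i j) ncoeff_mpoly_of sh_Sloc sh_add.
by case: ifP => [/(ncoeff_logc fL) //|/negbT/(ncoeff_notin fL)].
Qed.

Lemma local_gens_BR d S : Mconvex d S -> (local_gens R d S `<=` BR R d S)%classic.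
Proof.
move=> SM _ [b [v [bd T0 /BR_lower[C CP] ->]]]; apply/BR_lower; exists C => f fL.
apply: le_trans (CP _ (Lplus_deriv SM bd T0 fL)) _.
rewrite pair_lift_loc (@eq_pair _ _ _ _ _ (fun g => logc f (b + g)%mnm)) // => g gT.
by rewrite /logc ncoeff_mpoly_of gT expRK !opprK.
Qed.

Lemma Cone_local_gens_sub d S : Mconvex d S ->
  (Cone (local_gens R d S) `<=` BR R d S)%classic.
Proof. by move=> SM; apply: Cone_sub_BR; exact: local_gens_BR. Qed.

(* Reversed Cauchy-Schwarz for [e_i + m e_j] and [r e_k + s e_l], with the
   weights chosen so that every term of the mixed product is at most 1. *)
Lemma hyperbolic_four_point (A : 'M[R]_n) (i j k l : 'I_n) : A^T = A ->
  (forall p q, 0 <= A p q) -> hyperbolic A -> 0 < A i k -> 0 < A j l ->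
  A i l * A j k <= A i k * A j l -> A i j * A k l <= 4 * (A i k * A j l).
Proof.
move=> As A0 hA ik jl le.
have sA p q : A p q = A q p by rewrite -[in LHS]As mxE.
have bilE p q : bil A (delta_mx 0 p) (delta_mx 0 q) = A p q.
  by rewrite /bil -rowE trmx_delta -colE !mxE.
have [ij|ij0] := ltP 0 (A i j); last first.
  have -> : A i j = 0 by apply/eqP; rewrite eq_le ij0 A0.
  by rewrite mul0r !mulr_ge0 // ltW.
(* [m] lies between [A i l / A j l] and [A i k / A j k], in the right order by [le]; there is no
   upper constraint when [A j k = 0]. *)
have [m [m0 m1 m2]] : exists m, [/\ 0 < m, m * A j k <= A i k & A i l <= m * A j l].
  have [jk|jk0] := ltP 0 (A j k).
    exists (A i k / A j k); rewrite divr_gt0 // divfK ?gt_eqF //; split=> //.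
    by rewrite mulrAC ler_pdivlMr.
  have -> : A j k = 0 by apply/eqP; rewrite eq_le jk0 A0.
  exists ((A i l + 1) / A j l); rewrite divfK ?gt_eqF // mulr0; split.
  - by rewrite divr_gt0 // ltr_wpDl.
  - exact: ltW.
  - by rewrite lerDl.
pose r := (A i k)^-1; pose s := (m * A j l)^-1.
have r0 : 0 < r by rewrite invr_gt0.
have s0 : 0 < s by rewrite invr_gt0 mulr_gt0.
have rE : r * A i k = 1 by rewrite mulVf ?gt_eqF.
have sE : s * (m * A j l) = 1 by rewrite mulVf // gt_eqF // mulr_gt0.
pose x := delta_mx 0 i + m *: delta_mx 0 j : 'rV[R]_n.
pose y := r *: delta_mx 0 k + s *: delta_mx 0 l : 'rV[R]_n.
have qx : 2 * m * A i j <= bil A x x.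
  rewrite /x !bilDl !bilDr !bilZl !bilZr !bilE (sA j i).
  have := A0 i i; have := mulr_ge0 (mulr_ge0 (ltW m0) (ltW m0)) (A0 j j); lra.
have qy : 2 * (r * s * A k l) <= bil A y y.
  rewrite /y !bilDl !bilDr !bilZl !bilZr !bilE (sA l k).
  have := mulr_ge0 (mulr_ge0 (ltW r0) (ltW r0)) (A0 k k).
  have := mulr_ge0 (mulr_ge0 (ltW s0) (ltW s0)) (A0 l l); lra.
have Bxy : 0 <= bil A x y <= 4.
  have -> : bil A x y = r * A i k + s * A i l + r * (m * A j k) + s * (m * A j l).
    by rewrite /x /y !bilDl !bilDr !bilZl !bilZr !bilE; ring.
  rewrite rE sE.
  have h1 : s * A i l <= 1 by rewrite -sE ler_pM2l.
  have h2 : r * (m * A j k) <= 1 by rewrite -rE ler_pM2l.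
  have h3 := mulr_ge0 (ltW s0) (A0 i l).
  have h4 := mulr_ge0 (ltW r0) (mulr_ge0 (ltW m0) (A0 j k)).
  by apply/andP; split; lra.
have mij : 0 < 2 * m * A i j by rewrite !mulr_gt0.
have := hA x y (lt_le_trans mij qx) => h.
(* Since [m * r * s] is the inverse of [A i k * A j l], dividing 16 by the factor 4 on the left
   gives the constant of the statement. *)
have h1 : 2 * m * A i j * (2 * (r * s * A k l)) <= 16.
  apply: le_trans (_ : bil A x x * bil A y y <= _).
    by rewrite ler_pM // ?(ltW mij) // !mulr_ge0 // ltW.
  apply: le_trans h _; rewrite expr2 (_ : 16 = 4 * 4); last by ring.
  by case/andP: Bxy => *; rewrite ler_pM.
have h2 : (2 * m * A i j * (2 * (r * s * A k l))) * (A i k * A j l) =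
    4 * (A i j * A k l).
  have -> : (2 * m * A i j * (2 * (r * s * A k l))) * (A i k * A j l) =
    4 * (A i j * A k l) * (r * A i k) * (s * (m * A j l)) by ring.
  by rewrite rE sE !mulr1.
have := ler_wpM2r (ltW (mulr_gt0 ik jl)) h1; rewrite h2; lra.
Qed.

(** The logarithm of [hyperbolic_four_point]. A third product with an entry outside [S] is 0, so its
    comparison is required only when both entries are present. *)
Lemma logc_four_point d S (f : mpoly n R) b i j k l : Mconvex d S ->
  Lplus d S f ->
  sh b i j \in S -> sh b k l \in S -> sh b i k \in S -> sh b j l \in S ->
  (sh b i l \in S -> sh b j k \in S ->
    logc f (sh b i k) + logc f (sh b j l) <=
    logc f (sh b i l) + logc f (sh b j k)) ->
  logc f (sh b i k) + logc f (sh b j l) <=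
    logc f (sh b i j) + logc f (sh b k l) + ln 4.
Proof.
move=> [_ /fsubsetP SD _] fL ij kl ik jl h; have [[_ _ c0 _ hO] _] := fL.
have bd : (mdeg b + 2)%N = d.
  by apply/eqP; have := SD _ ij; rewrite in_Delta mdeg_sh.
have hyp := hyperbolic_of_one_pos (hess_sym f b) (hO b bd).
have hE p q : hess f b p q = ncoeff f (sh b p q) by rewrite mxE.
have h0 p q : 0 <= hess f b p q by rewrite hE.
have := @hyperbolic_four_point (hess f b) i j k l (hess_sym f b) h0 hyp.
rewrite !hE (ncoeff_logc fL ij) (ncoeff_logc fL kl) (ncoeff_logc fL ik).
rewrite (ncoeff_logc fL jl) => /(_ (expR_gt0 _) (expR_gt0 _)).
have E4 : expR (ln 4) = 4 :> R by apply: lnK; rewrite posrE ltr0n.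
have le : ncoeff f (sh b i l) * ncoeff f (sh b j k) <=
    expR (- logc f (sh b i k)) * expR (- logc f (sh b j l)).
  have e0 x y : 0 <= expR x * expR y :> R by rewrite mulr_ge0 ?expR_ge0.
  have [il|/(ncoeff_notin fL) ->] := boolP (sh b i l \in S); last first.
    by rewrite mul0r e0.
  have [jk|/(ncoeff_notin fL) ->] := boolP (sh b j k \in S); last first.
    by rewrite mulr0 e0.
  have := h il jk; rewrite (ncoeff_logc fL il) (ncoeff_logc fL jk).
  move: (logc f _) (logc f _) (logc f _) (logc f _) => p q r s hpq.
  by rewrite -!expRD ler_expR; clear -hpq; lra.
move/(_ le); move: (logc f _) (logc f _) (logc f _) (logc f _) => p q r s.
rewrite -{1}E4 -!expRD ler_expR; clear; move: (ln 4) => L; lra.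
Qed.

End Local.

(** * Local generators *)

Section Farkas.
Variables (R : realType) (n : nat) (S : {fset multinom n}).
Implicit Types (w : {ffun S -> R^o}) (nu : multinom n -> R).

Lemma Cone_sub (V : lmodType R) (E F : set V) : (E `<=` Cone F)%classic ->
  (Cone E `<=` Cone F)%classic.
Proof.
move=> EF _ [k [u [c [uE c0 ->]]]]; elim/big_ind: _ => [|v w|i _].
- exact: Cone0.
- exact: ConeD.
- by apply: ConeZ => //; apply: EF.
Qed.

(* Bartl's induction: when [a0] cannot be dropped there is [x] with
   [pair a x >= 0] on the other generators, [pair a0 x = -1] and
   [pair w x < 0]; shearing along [x] removes [a0]. *)
Lemma farkas (s : seq {ffun S -> R^o}) w :
  (forall nu, (forall a, a \in s -> 0 <= pair a nu) -> 0 <= pair w nu) ->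
  Cone [set a | a \in s]%classic w.
Proof.
move e : (size s) => m; elim: m s e w => [|m IHm] [|a0 s] //= e w hw.
  suff -> : w = 0 by exact: Cone0.
  apply/ffunP => x; rewrite ffunE.
  have := hw (fun a => 1 * (a == val x)%:R) (fun a => ltac:(by [])).
  have := hw (fun a => -1 * (a == val x)%:R) (fun a => ltac:(by [])).
  rewrite !pair_delta mul1r mulN1r oppr_ge0 => h1 h2.
  by apply/eqP; rewrite eq_le h1 h2.
case: e => e.
have sub_s : (Cone [set a | a \in s] `<=` Cone [set a | a \in a0 :: s])%classic.
  by apply: Cone_sub => a /= sa; apply: Cone_incl; rewrite /= inE sa orbT.
have a0C : Cone [set a | a \in a0 :: s]%classic a0.
  by apply: Cone_incl; rewrite /= inE eqxx.
have [h|/existsNP[x0 /not_implyP[x0s /negP]]] := pselect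
  (forall nu, (forall a, a \in s -> 0 <= pair a nu) -> 0 <= pair w nu).
  exact/sub_s/(IHm _ e).
rewrite -ltNge => wx0.
have a0x0 : pair a0 x0 < 0.
  rewrite ltNge; apply/negP => a0x0; move: wx0; rewrite ltNge hw // => a.
  by rewrite inE => /orP[/eqP -> //|/x0s].
pose x (b : multinom n) := (- pair a0 x0)^-1 * x0 b.
have n0 : 0 < (- pair a0 x0)^-1 by rewrite invr_gt0 oppr_gt0.
have a0x : pair a0 x = -1.
  by rewrite pairZr invrN mulNr mulVf // lt_eqF.
have xs a : a \in s -> 0 <= pair a x.
  by move=> sa; rewrite pairZr mulr_ge0 ?x0s // ltW.
have wx : pair w x < 0 by rewrite pairZr pmulr_rlt0.
pose sh0 (a : {ffun S -> R^o}) : {ffun S -> R^o} := a + pair a x *: a0.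
have shE a nu : pair (sh0 a) nu = pair a (fun b => nu b + pair a0 nu * x b).
  by rewrite pairDl pairDr pairZl pairZr mulrC.
have -> : w = sh0 w + - pair w x *: a0.
  by rewrite /sh0 scaleNr addrK.
apply: ConeD; last by apply: ConeZ => //; rewrite oppr_ge0 ltW.
suff : Cone [set a | a \in map sh0 s]%classic (sh0 w).
  apply: Cone_sub => _ /= /mapP[a sa ->]; apply: ConeD.
    by apply: sub_s; apply: Cone_incl.
  by apply: ConeZ => //; exact: xs.
apply: IHm => [|nu hnu]; first by rewrite size_map.
rewrite shE; apply: hw => a.
rewrite inE => /orP[/eqP ->|sa].
  by rewrite pairDr pairZr a0x mulrN1 subrr.
by rewrite -shE hnu // map_f.
Qed.

End Farkas.

Section Generators.
Variables (R : realType) (n : nat).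
Implicit Types (S : {fset multinom n}) (b : multinom n) (nu : multinom n -> R).

(* The four-point condition is a linear inequality when [i = j], and a linear
   equality when the third product of the triple vanishes. *)
Definition gen_cond S b (i j k l : 'I_n) : bool :=
  [&& sh b i j \in S, sh b k l \in S, sh b i k \in S, sh b j l \in S
    & (i == j) || ~~ ((sh b i l \in S) && (sh b j k \in S))].

Definition gen S b (i j k l : 'I_n) : {ffun S -> R^o} :=
  eps R S (sh b i j) + eps R S (sh b k l) - eps R S (sh b i k) - eps R S (sh b j l).

Definition loc S nu : Prop := forall b i j k l, gen_cond S b i j k l ->
  nu (sh b i k) + nu (sh b j l) <= nu (sh b i j) + nu (sh b k l).

Lemma pair_gen S b i j k l nu :
  sh b i j \in S -> sh b k l \in S -> sh b i k \in S -> sh b j l \in S ->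
  pair (gen S b i j k l) nu =
    nu (sh b i j) + nu (sh b k l) - nu (sh b i k) - nu (sh b j l).
Proof. by move=> ? ? ? ?; rewrite !(pairDl, pairNl) !pair_eps. Qed.

(** The ratio is at most 4: the comparison with the third product is vacuous, or an equality when
    [i = j]. *)
Lemma gen_local d S b i j k l : Mconvex d S -> gen_cond S b i j k l ->
  local_gens R d S (gen S b i j k l).
Proof.
move=> SM /and5P[ij kl ik jl cond].
have bd : (mdeg b + 2)%N = d.
  by have [_ /fsubsetP/(_ _ ij)] := SM; rewrite in_Delta mdeg_sh => /eqP.
have ijT : sh mnm0 i j \in Sloc S b by rewrite sh_Sloc.
have T0 : Sloc S b != fset0 by apply/fset0Pn; exists (sh mnm0 i j).
exists b, (gen (Sloc S b) mnm0 i j k l); split=> //; last first.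
  apply: pair_inj => nu; rewrite pair_lift_loc !pair_gen ?sh_Sloc //.
  by rewrite !sh_add.
apply/BR_lower; exists (ln 4) => f fL; rewrite pair_gen ?sh_Sloc //.
have := @logc_four_point _ _ 2 _ f mnm0 i j k l (Mconvex_Sloc SM T0) fL.
rewrite !sh_Sloc => /(_ ij kl ik jl) h.
suff h' : logc f (sh mnm0 i k) + logc f (sh mnm0 j l) <=
    logc f (sh mnm0 i j) + logc f (sh mnm0 k l) + ln 4.
  move: h'; clear; move: (logc f _) (logc f _) (logc f _) (logc f _) (ln 4).
  by move=> p q r s t; lra.
apply: h => il jk; move: cond; rewrite il jk orbF => /eqP ->.
by move: (logc f _) (logc f _) => p q; rewrite addrC.
Qed.

Definition gens d S : seq {ffun S -> R^o} :=
  [seq gen S (val t.1.1) t.1.2.1 t.1.2.2 t.2.1 t.2.2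
  | t <- enum {: (Delta n (d - 2) * ('I_n * 'I_n) * ('I_n * 'I_n))%type}
  & gen_cond S (val t.1.1) t.1.2.1 t.1.2.2 t.2.1 t.2.2].

Lemma BR_eq_Cone d S : Mconvex d S ->
  (forall w : {ffun S -> R^o}, BR R d S w -> forall nu, loc S nu ->
    0 <= pair w nu) ->
  BR R d S = Cone (local_gens R d S).
Proof.
move=> SM h; apply/seteqP; split; last exact: Cone_local_gens_sub.
move=> w /h hw.
have : Cone [set a | a \in gens d S]%classic w.
  apply: farkas => nu hnu; apply: hw => b i j k l c.
  have /and5P[ij kl ik jl _] := c.
  have bD : b \in Delta n (d - 2).
    have [_ /fsubsetP/(_ _ ij)] := SM; rewrite !in_Delta mdeg_sh => /eqP <-.
    by rewrite addnK.
  have /hnu : gen S b i j k l \in gens d S.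
    apply/mapP; exists ([` bD], (i, j), (k, l)) => //.
    by rewrite mem_filter /= c mem_enum.
  by rewrite pair_gen //; move: (nu _) (nu _) (nu _) (nu _) => p q r s; lra.
apply: Cone_sub => a /= /mapP[t]; rewrite mem_filter => /andP[c _ ->].
by apply: Cone_incl; exact: gen_local.
Qed.

Lemma BR_eq_Cone_deg2 S : Mconvex 2 S -> BR R 2 S = Cone (local_gens R 2 S).
Proof.
move=> SM; apply/seteqP; split; last exact: Cone_local_gens_sub.
move=> w wB; apply: Cone_incl.
have ST : Sloc S mnm0 = S.
  apply/fsetP => g; rewrite in_Sloc add0m andbC; case gS: (g \in S) => //=.
  by have [_ /fsubsetP/(_ _ gS)] := SM; rewrite in_Delta.
(* In degree 2, [S] is its own local support at 0, so [w] is itself a generator, once transported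
   along [ST]. *)
have [v [vB vw]] : exists v : {ffun Sloc S mnm0 -> R^o},
    BR R 2 (Sloc S mnm0) v /\ forall nu, pair v nu = pair w nu.
  by rewrite ST; exists w.
exists mnm0, v; split=> //; first by rewrite mdeg0.
  by rewrite ST; case: SM.
apply: pair_inj => nu; rewrite pair_lift_loc -vw; apply: eq_pair => g _.
by rewrite add0m.
Qed.

(** Exchanging [i] out of the first exponent must bring in [k] or [l], the only indices where the
    second exponent can be larger; each choice gives one of the two pairings. *)
Lemma Mconvex_exchange d S b i j k l : Mconvex d S ->
  sh b i j \in S -> sh b k l \in S ->
  (sh b i k \in S) && (sh b j l \in S) || (sh b i l \in S) && (sh b j k \in S).
Proof.
move=> [_ _ SX] ij kl.
have [ki|ik] := eqVneq k i; first by subst k; rewrite kl (shC b j i) ij orbT.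
have [li|il] := eqVneq l i; first by subst l; rewrite (shC b i k) kl (shC b j i) ij.
have lt : (sh b k l i < sh b i j i)%N.
  by rewrite !shE eqxx (negbTE ik) (negbTE il); lia.
have [m [lm m1 m2]] := SX _ _ i ij kl lt.
have e1 : (sh b i j - 'e_i + 'e_m)%mnm = sh b j m.
  apply/mnmP => p; rewrite mnmDE mnmBE !shE !mnm1E.
  by case: (eqVneq i p) => _ /=; lia.
have [mk|mk] := eqVneq k m.
  have e2 : (sh b k l - 'e_m + 'e_i)%mnm = sh b i l.
    apply/mnmP => p; rewrite mnmDE mnmBE !shE !mnm1E -mk.
    by case: (eqVneq k p) => _ /=; lia.
  by rewrite -e2 m2 mk -e1 m1 orbT.
have [ml|ml] := eqVneq l m.
  have e2 : (sh b k l - 'e_m + 'e_i)%mnm = sh b i k.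
    apply/mnmP => p; rewrite mnmDE mnmBE !shE !mnm1E -ml.
    by case: (eqVneq l p) => _ /=; lia.
  by rewrite -e2 m2 ml -e1 m1.
by move: lm; rewrite !shE (negbTE mk) (negbTE ml) !addn0 -addnA ltnNge leq_addr.
Qed.

End Generators.

(** * Equality for few variables, and for [(n, d) = (4, 3)] *)

Section LocTrop.
Variables (R : realType) (n d : nat) (S : {fset multinom n}).
Hypothesis SM : Mconvex d S.
Implicit Types (b : multinom n) (nu : multinom n -> R).

Lemma loc_diag nu b i k l : loc S nu -> sh b i i \in S -> sh b k l \in S ->
  [/\ sh b i k \in S, sh b i l \in S &
    nu (sh b i k) + nu (sh b i l) <= nu (sh b i i) + nu (sh b k l)].
Proof.
move=> lS ii kl.
have [ik il] : sh b i k \in S /\ sh b i l \in S.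
  by case/orP: (Mconvex_exchange SM ii kl) => /andP[].
by split=> //; apply: lS; rewrite /gen_cond ii kl ik il eqxx.
Qed.

(** A repeated index makes the condition trivial or one of the linear inequalities, and a missing
    product makes it linear too. Only four distinct indices with all six entries present remain. *)
Lemma trop_of_loc nu : loc S nu ->
  (forall b i j k l, uniq [:: i; j; k; l] ->
    sh b i j \in S -> sh b k l \in S -> sh b i k \in S -> sh b j l \in S ->
    sh b i l \in S -> sh b j k \in S ->
    nu (sh b i k) + nu (sh b j l) <= nu (sh b i j) + nu (sh b k l) \/
    nu (sh b i l) + nu (sh b j k) <= nu (sh b i j) + nu (sh b k l)) ->
  trop S nu.
Proof.
move=> lS four.
have key b i j k l : sh b i j \in S -> sh b k l \in S ->
    sh b i k \in S -> sh b j l \in S ->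
    nu (sh b i k) + nu (sh b j l) <= nu (sh b i j) + nu (sh b k l) \/
    [/\ sh b i l \in S, sh b j k \in S
    & nu (sh b i l) + nu (sh b j k) <= nu (sh b i j) + nu (sh b k l)].
  move=> ij kl ik jl.
  have [/andP[il jk]|m] := boolP ((sh b i l \in S) && (sh b j k \in S)); last first.
    by left; apply: lS; rewrite /gen_cond ij kl ik jl m orbT.
  have [eij|nij] := eqVneq i j.
    by left; apply: lS; rewrite /gen_cond ij kl ik jl eij eqxx.
  have [ekl|nkl] := eqVneq k l.
    left; rewrite (shC b i k) (shC b j l) [leRHS]addrC; apply: lS.
    by rewrite /gen_cond ij kl (shC b k i) ik (shC b l j) jl ekl eqxx.
  have [eik|nik] := eqVneq i k.
    by right; subst k; rewrite (shC b j i) [leRHS]addrC.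
  have [eil|nil] := eqVneq i l.
    by left; subst l; rewrite (shC b i k) (shC b j i) addrC.
  have [ejk|njk] := eqVneq j k.
    by left; subst k.
  have [ejl|njl] := eqVneq j l.
    by right; subst l; rewrite (shC b j k).
  have [|h|h] := four b i j k l _ ij kl ik jl il jk; [|by left|by right].
  by rewrite /= !inE !negb_or nij nik nil njk njl nkl.
move=> b i j k l ij kl.
case/orP: (Mconvex_exchange SM ij kl) => /andP[h1 h2].
  by have [h|h] := key b i j k l ij kl h1 h2; [left|right].
have lk : sh b l k \in S by rewrite shC.
have [h|h] := key b i j l k ij lk h1 h2; [right; split|left] => //.
  by rewrite (shC b k l).
by rewrite (shC b k l).
Qed.

Lemma loc_le3 nu : (n <= 3)%N -> loc S nu -> trop S nu.
Proof.
move=> n3 lS; apply: trop_of_loc => // b i j k l u.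
by have := max_card [in [:: i; j; k; l]]; rewrite (card_uniqP u) card_ord /=; lia.
Qed.

Definition lin (c : 'I_n -> R) (a : multinom n) : R := \sum_i c i * (a i)%:R.

Lemma lin_sh c b i j : lin c (sh b i j) = lin c b + c i + c j.
Proof.
rewrite /lin; under eq_bigr do rewrite shE !natrD !mulrDr.
have delta p : \sum_r c r * (p == r)%:R = c p.
  rewrite (bigD1 p) //= eqxx mulr1 big1 ?addr0 // => r /negbTE rp.
  by rewrite eq_sym rp mulr0.
by rewrite !big_split /= !delta.
Qed.

(** The three sums coincide on a linear function. Such functions, tropical with either sign, serve
    to normalize [nu] without affecting [loc]. *)
Lemma trop_lin c : trop S (lin c).
Proof.
move=> b i j k l ij kl.
by case/orP: (Mconvex_exchange SM ij kl) => /andP[h1 h2]; [left|right];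
  split=> //; rewrite !lin_sh; lra.
Qed.

Lemma loc_lin nu c : loc S nu -> loc S (fun a => nu a - lin c a).
Proof.
by move=> lS b i j k l /lS; rewrite !lin_sh; lra.
Qed.

End LocTrop.

(** * Cubics in four variables *)

Section FourThree.
Variables (R : realType) (S : {fset multinom 4}).
Hypothesis SM : Mconvex 3 S.
Implicit Types (b : multinom 4) (nu : multinom 4 -> R) (i j k l : 'I_4).

(* The exponents of degree 3 in four variables are the [2 e_i + e_j] (with
   [i = j] allowed) and the square-free ones, indexed by the missing variable. *)
Definition dbl i j : multinom 4 := sh (mnm1 i) i j.
Definition omit l : multinom 4 := Multinom [tuple (m != l : nat) | m < 4].

Lemma uniq4_in i j k l m : uniq [:: i; j; k; l] -> m \in [:: i; j; k; l].
Proof.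
move=> u; suff -> : m \in [:: i; j; k; l] = (m \in 'I_4) by [].
apply/subset_cardP; last by apply/fintype.subsetP.
by rewrite (card_uniqP u) card_ord.
Qed.

Lemma exists_notin (s : seq 'I_4) : (size s < 4)%N -> exists k, k \notin s.
Proof.
move=> s4; apply/existsP; apply: contraT => /existsPn h.
have : (#|'I_4| <= #|s|)%N.
  by apply/subset_leq_card/fintype.subsetP => k _; have := h k; rewrite negbK.
by rewrite card_ord leqNgt (leq_ltn_trans (card_size s) s4).
Qed.

Lemma fourth i j k : i != j -> i != k -> j != k ->
  exists l, uniq [:: i; j; k; l].
Proof.
move=> ij ik jk; have [l] := @exists_notin [:: i; j; k] isT.
rewrite !inE !negb_or => /and3P[li lj lk]; exists l.
by rewrite /= !inE !negb_or ij ik jk !(eq_sym _ l) li lj lk.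
Qed.

Lemma uniq4_swap12 i j k l : uniq [:: i; j; k; l] -> uniq [:: j; i; k; l].
Proof.
rewrite /= !inE !negb_or !andbT => /and3P[/and3P[ij ik il] /andP[jk jl] kl].
by rewrite eq_sym ij ik il jk jl kl.
Qed.

Lemma uniq4_swap23 i j k l : uniq [:: i; j; k; l] -> uniq [:: i; k; j; l].
Proof.
rewrite /= !inE !negb_or !andbT => /and3P[/and3P[ij ik il] /andP[jk jl] kl].
by rewrite (eq_sym k j) ij ik il jk jl kl.
Qed.

Lemma uniq4_swap34 i j k l : uniq [:: i; j; k; l] -> uniq [:: i; j; l; k].
Proof.
rewrite /= !inE !negb_or !andbT => /and3P[/and3P[ij ik il] /andP[jk jl] kl].
by rewrite (eq_sym l k) ij ik il jk jl kl.
Qed.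

Lemma big4 i j k l (F : 'I_4 -> R) : uniq [:: i; j; k; l] ->
  \sum_m F m = F i + F j + F k + F l.
Proof.
move=> u; rewrite (eq_bigl [in [:: i; j; k; l]]) => [|m]; last by rewrite uniq4_in.
by rewrite -big_uniq //= !big_cons big_nil addr0 !addrA.
Qed.

Lemma omitE i j k l : uniq [:: i; j; k; l] -> sh (mnm1 i) j k = omit l.
Proof.
move=> u; apply/mnmP => m; rewrite shE mnm1E mnmE.
have := uniq4_in m u; move: u; rewrite /= !inE !negb_or !andbT.
case/and3P => /and3P[ij ik il] /andP[jk jl] kl.
have nE p q : p != q -> (p == q = false) * (q == p = false).
  by move=> /negbTE pq; rewrite pq eq_sym pq.
by case/or4P => /eqP ->; rewrite !(nE _ _ _ ij, nE _ _ _ ik, nE _ _ _ il, nE _ _ _ jk,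
  nE _ _ _ jl, nE _ _ _ kl, eqxx).
Qed.

Lemma dblC i j : sh (mnm1 i) j i = dbl i j. Proof. exact: shC. Qed.

Lemma dblE i j : sh (mnm1 j) i i = dbl i j.
Proof. by apply/mnmP => m; rewrite !shE !mnm1E; lia. Qed.

Lemma dbl_inj i j i' j' : dbl i j = dbl i' j' -> i = i' /\ j = j'.
Proof.
move=> /mnmP e; have [ei ej] := (e i, e j); move: ei ej.
rewrite !shE !mnm1E !eqxx.
have [->|ni] := eqVneq i' i; have [->|nj] := eqVneq j' j => //.
- by case: (eqVneq i j); case: (eqVneq j' i); lia.
- by case: (eqVneq j i); lia.
- case: (eqVneq i j); case: (eqVneq j' i); case: (eqVneq i' j); lia.
Qed.

Lemma dbl_omit i j l : dbl i j != omit l.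
Proof.
apply/eqP => /mnmP/(_ i); rewrite shE mnm1E eqxx mnmE.
by case: (i == l); case: (j == i).
Qed.

(** With the square-free values normalized to 0, the three sums at [e_i] are the off-diagonal
    entries of row [i] of [U]: distinct nonlinear conditions involve distinct rows. *)
Definition cubic (U : 'I_4 -> 'I_4 -> R) (a : multinom 4) : R :=
  \sum_i \sum_j (a == dbl i j)%:R * U i j.

Lemma cubic_dbl U i j : cubic U (dbl i j) = U i j.
Proof.
rewrite /cubic (bigD1 i) //= (bigD1 j) //= eqxx mul1r !big1 ?addr0 // =>
   [m /negbTE mi|m /negbTE mj].
  by rewrite big1 // => p _; case: eqP => [/dbl_inj[e]|_]; rewrite ?mul0r // e eqxx in mi *.
by case: eqP => [/dbl_inj[_ e]|_]; rewrite ?mul0r // e eqxx in mj *.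
Qed.

Lemma cubic_omit U l : cubic U (omit l) = 0.
Proof.
rewrite /cubic big1 // => i _; rewrite big1 // => j _.
by rewrite eq_sym (negbTE (dbl_omit i j l)) mul0r.
Qed.

Lemma mem_Delta43 a : a \in S -> (exists i j, a = dbl i j) \/ exists l, a = omit l.
Proof.
move=> aS; have /mdegSP[k [_ [-> /mdeg2P[i [j ->]]]]] : mdeg a = 3%N.
  by have [_ /fsubsetP/(_ _ aS)] := SM; rewrite in_Delta => /eqP.
have -> : (sh mnm0 i j + mnm1 k)%mnm = sh (mnm1 i) j k.
  by rewrite /sh add0m.
have [->|ij] := eqVneq j i; first by left; exists i, k.
have [->|ik] := eqVneq k i; first by left; exists i, j; rewrite dblC.
have [->|jk] := eqVneq k j; first by left; exists j, i; rewrite dblE.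
rewrite eq_sym in ij; rewrite eq_sym in ik; rewrite eq_sym in jk.
have [l u] := fourth ij ik jk.
by right; exists l; rewrite (omitE u).
Qed.

End FourThree.

Section Decomposition.
Variables (R : realType) (S : {fset multinom 4}).
Hypothesis SM : Mconvex 3 S.
Implicit Types (nu : multinom 4 -> R) (i j k l : 'I_4).
Implicit Types (p e : 'I_4 -> R) (t : 'I_4 -> 'I_4 -> R).

(** All six entries of the nonlinear condition at [e_i] are present. *)
Definition full_row i : Prop :=
  forall j, j != i -> dbl i j \in S /\ omit j \in S.

(* [p i] is the least off-diagonal entry of row [i] and [t i j] the excess over
   it; [2 * p i + \sum_l t i l] is the least diagonal entry allowed. *)
Definition layered p t e i j : R :=
  if j == i then 2 * p i + \sum_l t i l + e i else p i + t i j.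

Lemma layered_diag p t e i : layered p t e i i = 2 * p i + \sum_l t i l + e i.
Proof. by rewrite /layered eqxx. Qed.

Lemma layered_off p t e i j : i != j -> layered p t e i j = p i + t i j.
Proof. by rewrite /layered eq_sym => /negbTE ->. Qed.

(* The nonlinear condition at [e_i] says that the minimum of row [i] is attained
   twice, which holds as soon as a full row has at most one positive excess. *)
Lemma layered_trop p t e :
  (forall i, 0 <= p i) -> (forall i, 0 <= e i) -> (forall i j, 0 <= t i j) ->
  (forall i j k, j != k -> t i j = 0 \/ t i k = 0) ->
  (forall i j, i != j -> dbl i j \in S -> dbl j i \in S ->
    t i j <= p j + t j i) ->
  (forall i, full_row i \/ forall j, t i j = 0) ->
  trop S (cubic (layered p t e)).
Proof.
move=> p0 e0 t0 t1 tp tD.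
have tsum i j : t i j <= \sum_l t i l.
  by rewrite (bigD1 j) //= lerDl sumr_ge0.
have tsum2 i j k : j != k -> t i j + t i k <= \sum_l t i l.
  move=> jk; rewrite (bigD1 j) //= (bigD1 k) 1?eq_sym //= lerD2l lerDl.
  by rewrite sumr_ge0.
have V0 i j : 0 <= layered p t e i j.
  by rewrite /layered; case: ifP => _; rewrite !addr_ge0 ?mulr_ge0 ?sumr_ge0.
have mdeg1S b i j : sh b i j \in S -> exists m, b = mnm1 m.
  move=> ij; have : mdeg b = 1%N.
    have [_ /fsubsetP/(_ _ ij)] := SM; rewrite in_Delta mdeg_sh => /eqP.
    by lia.
  by move/eqP/mdeg1P => [m /eqP ->]; exists m.
have cyc i j k l : uniq [:: i; j; k; l] ->
    [/\ uniq [:: j; i; l; k], uniq [:: k; l; i; j] & uniq [:: l; k; j; i]].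
  move=> u; have u' := uniq4_swap34 (uniq4_swap12 u).
  have v := uniq4_swap23 (uniq4_swap34 (uniq4_swap12 (uniq4_swap23 u))).
  by split=> //; apply: uniq4_swap34; exact: uniq4_swap12.
have perm i j k l : uniq [:: i; j; k; l] ->
    [/\ uniq [:: i; k; j; l], uniq [:: i; k; l; j] & uniq [:: i; j; l; k]].
  move=> u; have v := uniq4_swap23 u.
  by split=> //; exact: uniq4_swap34.
have omits i j k l : uniq [:: i; j; k; l] ->
    [/\ sh (mnm1 i) j k = omit l, sh (mnm1 i) j l = omit k &
      sh (mnm1 i) k l = omit j].
  by move=> u; have [_ u1 u2] := perm _ _ _ _ u; split; apply: omitE.
have uneq i j k l : uniq [:: i; j; k; l] -> [/\ i != j, i != k, i != l & k != l].
  by rewrite /= !inE !negb_or !andbT => /and3P[/and3P[-> -> ->] _ ->].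
(* A missing product means that row [i] is not full, so its excesses vanish and both sides equal
   [p i]. *)
have row i j k l : uniq [:: i; j; k; l] ->
    ~~ ((sh (mnm1 i) i l \in S) && (sh (mnm1 i) j k \in S)) ->
    cubic (layered p t e) (sh (mnm1 i) i k) + cubic (layered p t e) (sh (mnm1 i) j l) <=
    cubic (layered p t e) (sh (mnm1 i) i j) + cubic (layered p t e) (sh (mnm1 i) k l).
  move=> u; have [-> -> ->] := omits _ _ _ _ u; have [ij ik il _] := uneq _ _ _ _ u.
  rewrite -!/(dbl _ _) !cubic_dbl !cubic_omit !layered_off // => nl.
  case: (tD i) => [D|t00]; last by rewrite !t00.
  by have [dl ol] := D l (ltac:(by rewrite eq_sym)); rewrite dl ol in nl.
have six i j k l : uniq [:: i; j; k; l] ->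
    cubic (layered p t e) (sh (mnm1 i) i k) + cubic (layered p t e) (sh (mnm1 i) j l) <=
      cubic (layered p t e) (sh (mnm1 i) i j) + cubic (layered p t e) (sh (mnm1 i) k l) \/
    cubic (layered p t e) (sh (mnm1 i) i l) + cubic (layered p t e) (sh (mnm1 i) j k) <=
      cubic (layered p t e) (sh (mnm1 i) i j) + cubic (layered p t e) (sh (mnm1 i) k l).
  move=> u; have [-> -> ->] := omits _ _ _ _ u; have [ij ik il kl] := uneq _ _ _ _ u.
  rewrite -!/(dbl _ _) !cubic_dbl !cubic_omit !layered_off //; have := t0 i j.
  by have [->|->] := t1 i k l kl; [left|right]; lra.
apply: (trop_of_loc SM) => [b i j k l c|b i j k l u ij kl ik jl il jk].
  have /and5P[ij kl ik jl] := c; have [m bm] := mdeg1S _ _ _ ij; subst b.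
  case/orP=> [/eqP eij|nc].
    subst j; have [eki|ki] := eqVneq k i.
      by subst k.
    have [eli|li] := eqVneq l i.
      by subst l; rewrite addrC (shC _ k i).
    have [emi|mi] := eqVneq m i.
      subst m; rewrite -/(dbl i i) -/(dbl i k) -/(dbl i l) !cubic_dbl.
      rewrite -/(dbl i i) in ij; rewrite -/(dbl i k) in ik.
      rewrite layered_diag !layered_off 1?eq_sym //.
      have [ekl|kl'] := eqVneq k l.
        subst l; rewrite dblE in kl; rewrite dblE cubic_dbl layered_off //.
        have := tp i k _ ik kl; rewrite eq_sym ki => /(_ isT).
        by have := tsum i k; have := e0 i; lra.
      have ik' : i != k by rewrite eq_sym.
      have il' : i != l by rewrite eq_sym.
      have [q u] := fourth ik' il' kl'.
      by rewrite (omitE u) cubic_omit; have := tsum2 i k l kl'; have := e0 i; lra.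
    have im : i != m by rewrite eq_sym.
    rewrite dblE; rewrite dblE in ij.
    have [ekm|km] := eqVneq k m.
      subst k; rewrite (shC _ i m) -/(dbl m i) -/(dbl m l).
      rewrite (shC _ i m) -/(dbl m i) in ik.
      have tpm := tp m i mi ik ij.
      have [elm|lm] := eqVneq l m.
        subst l; rewrite (shC _ i m) -/(dbl m i) !cubic_dbl layered_diag !layered_off //.
        by have := tsum m i; have := e0 m; lra.
      have ml : m != l by rewrite eq_sym.
      have il : i != l by rewrite eq_sym.
      have [q u] := fourth mi ml il.
      rewrite (omitE u) cubic_omit !cubic_dbl !layered_off //.
      by have := t0 m l; lra.
    have mk : m != k by rewrite eq_sym.
    have ik' : i != k by rewrite eq_sym.
    have [q u] := fourth mi mk ik'.
    have [elm|lm] := eqVneq l m.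
      subst l; rewrite (shC _ k m) -/(dbl m k) (shC _ i m) -/(dbl m i).
      rewrite (omitE u) cubic_omit !cubic_dbl !layered_off //.
      rewrite (shC _ i m) -/(dbl m i) in jl.
      by have := tp m i mi jl ij; have := t0 m k; lra.
    have [ekl|kl'] := eqVneq k l.
      subst l; rewrite dblE (omitE u) cubic_omit !cubic_dbl.
      by rewrite addr0 addr_ge0.
    have ml : m != l by rewrite eq_sym.
    have il : i != l by rewrite eq_sym.
    have {q}u : uniq [:: m; i; k; l].
      by rewrite /= !inE !negb_or mi mk ml ik' il kl'.
    have [u1 _ u2] := perm _ _ _ _ u; have [_ u3 _] := perm _ _ _ _ u.
    by rewrite (omitE u) (omitE u2) (omitE u3) !cubic_omit cubic_dbl !addr0.
  have [e'|nij] := eqVneq i j; first by subst j; rewrite jl ik in nc.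
  have [e'|nik] := eqVneq i k.
    by subst k; rewrite kl (shC _ j i) ij in nc.
  have [e'|nil] := eqVneq i l.
    by subst l; rewrite addrC (shC _ i k) (shC _ j i).
  have [e'|njk] := eqVneq j k; first by subst k.
  have [e'|njl] := eqVneq j l.
    by subst l; rewrite ij (shC _ j k) kl in nc.
  have [e'|nkl] := eqVneq k l; first by subst l; rewrite ik jl in nc.
  have u : uniq [:: i; j; k; l].
    by rewrite /= !inE !negb_or nij nik nil njk njl nkl.
  have [uj uk ul] := cyc _ _ _ _ u.
  have := uniq4_in m u; rewrite !inE => /or4P[] /eqP em; subst m.
  - exact: row.
  - have := row j i l k uj; rewrite (shC _ j i) (shC _ l k) addrC; apply.
    by rewrite andbC.
  - have := row k l i j uk; rewrite (shC _ l j) (shC _ k i) [leRHS]addrC; apply.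
    by rewrite (shC _ k j) (shC _ l i) andbC.
  - have := row l k j i ul; rewrite (shC _ l j) (shC _ k i) (shC _ l k) (shC _ j i).
    rewrite addrC [leRHS]addrC; apply.
    by rewrite (shC _ l i) (shC _ k j).
have [m bm] := mdeg1S _ _ _ ij; subst b.
have [uj uk ul] := cyc _ _ _ _ u.
have := uniq4_in m u; rewrite !inE => /or4P[] /eqP em; subst m.
- exact: six.
- have := six j i l k uj; rewrite (shC _ j i) (shC _ l k).
  by case=> h; [left|right]; lra.
- have := six k l i j uk; rewrite (shC _ l j) (shC _ k i) (shC _ k j) (shC _ l i).
  by case=> h; [left|right]; lra.
- have := six l k j i ul; rewrite (shC _ l j) (shC _ k i) (shC _ l k) (shC _ j i).
  rewrite (shC _ l i) (shC _ k j).
  by case=> h; [left|right]; lra.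
Qed.

End Decomposition.

Section Splitting.
Variables (R : realType) (S : {fset multinom 4}).
Hypothesis SM : Mconvex 3 S.
Implicit Types (nu : multinom 4 -> R) (i j k l : 'I_4).
Implicit Types (p e : 'I_4 -> R) (t : 'I_4 -> 'I_4 -> R).

(** [layered] is jointly linear in [p], [t] and [e], so a function can be split by splitting these
    parameters. *)
Lemma pair_layered (w : {ffun S -> R^o}) (a : R) p e t p' e' t' :
  pair w (cubic (layered (fun i => a * p i + p' i) (fun i j => a * t i j + t' i j)
    (fun i => a * e i + e' i))) =
  a * pair w (cubic (layered p t e)) + pair w (cubic (layered p' t' e')).
Proof.
rewrite -pairZr -pairDr; apply: eq_pair => x _; rewrite /cubic mulr_sumr -big_split.
apply: eq_bigr => i _ /=; rewrite mulr_sumr -big_split; apply: eq_bigr => j _ /=.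
rewrite /layered; case: ifP => _; last by ring.
by rewrite big_split /= -mulr_sumr; ring.
Qed.

Lemma eq_pair_layered (w : {ffun S -> R^o}) p e t p' e' t' : p =1 p' -> e =1 e' ->
  t =2 t' -> pair w (cubic (layered p t e)) = pair w (cubic (layered p' t' e')).
Proof.
move=> /funext -> /funext -> tt'; rewrite (_ : t = t') //.
by apply/funext => i; apply/funext => j.
Qed.

Lemma pair_layered_ge0_sum (w : {ffun S -> R^o}) (I : Type) (s : seq I) (a : R)
    (p : I -> 'I_4 -> R) (t : I -> 'I_4 -> 'I_4 -> R) : 0 <= a ->
  (forall x, 0 <= pair w (cubic (layered (p x) (t x) (fun=> 0)))) ->
  0 <= pair w (cubic (layered (fun i => a * \sum_(x <- s) p x i)
    (fun i j => a * \sum_(x <- s) t x i j) (fun=> 0))).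
Proof.
move=> a0 h; elim: s => [|x s IHs].
  rewrite (@eq_pair _ _ _ _ _ (fun=> 0)).
    by rewrite /pair big1 // => x _; rewrite mulr0.
  move=> x _; rewrite /cubic big1 // => i _; rewrite big1 // => j _.
  rewrite /layered; under [X in 2 * _ + X]eq_bigr do rewrite big_nil mulr0.
  by rewrite !big_nil big1 // !mulr0 !addr0 if_same mulr0.
rewrite (@eq_pair_layered w _ _ _ (fun i => a * p x i + a * \sum_(x <- s) p x i)
  (fun i => a * 0 + 0)
  (fun i j => a * t x i j + a * \sum_(x <- s) t x i j)) ?pair_layered.
- by rewrite addr_ge0 ?mulr_ge0.
- by move=> i; rewrite big_cons mulrDr.
- by move=> i; rewrite mulr0 addr0.
- by move=> i j; rewrite big_cons mulrDr.
Qed.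

(* Splits [nu] as one piece per column [k], carrying [p k] and the part of
   [t i k] exceeding [t k i], one piece per pair [{i, k}], carrying
   [min (t i k) (t k i)], and a diagonal remainder. *)
Lemma pair_decomp nu (w : {ffun S -> R^o}) : BR R 3 S w -> loc S nu ->
  (forall l, omit l \in S -> nu (omit l) = 0) ->
  (forall i j, i != j -> dbl i j \in S -> 0 <= nu (dbl i j)) ->
  (forall i, full_row S i \/
    (forall j k, i != j -> i != k -> dbl i j \in S -> dbl i k \in S ->
      nu (dbl i j) = nu (dbl i k)) /\ dbl i i \notin S) ->
  0 <= pair w nu.
Proof.
move=> wB lS y0 U0 rows; pose U i j := nu (dbl i j).
have /choice[p pP] : forall i, exists x, [/\ 0 <= x,
    forall j, i != j -> dbl i j \in S -> x <= U i j
  & forall j, i != j -> dbl i j \in S ->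
      exists k, [/\ i != k, dbl i k \in S & U i k = x]].
  move=> i.
  pose P j := (i != j) && (dbl i j \in S).
  case: (pickP P) => [j0 Pj0|P0]; last first.
    by exists 0; split=> // j ij ijS; have := P0 j; rewrite /P ij ijS.
  pose j1 := [arg min_(j < j0 | P j) U i j]%O.
  have [/andP[ij1 j1S] jmin] : P j1 /\ forall j, P j -> U i j1 <= U i j.
    by rewrite /j1; case: arg_minP.
  exists (U i j1); split; first exact: U0.
    by move=> j ij ijS; apply: jmin; rewrite /P ij.
  by move=> _ _ _; exists j1.
have p0 i : 0 <= p i by case: (pP i).
have pU i j : i != j -> dbl i j \in S -> p i <= U i j by case: (pP i) => _ + _; apply.
have pE i j : i != j -> dbl i j \in S ->
    exists k, [/\ i != k, dbl i k \in S & U i k = p i].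
  by case: (pP i) => _ _; apply.
pose t i j := if (i != j) && (dbl i j \in S) then U i j - p i else 0.
have tE i j : i != j -> dbl i j \in S -> t i j = U i j - p i.
  by move=> ij ijS; rewrite /t ij ijS.
have t0 i j : 0 <= t i j.
  by rewrite /t; case: ifP => // /andP[ij ijS]; rewrite subr_ge0 pU.
have tii i : t i i = 0 by rewrite /t eqxx.
(* The right side is [U j i]. The diagonal inequality for [2 e_j] at [e_i] is applied with the [k]
   at which row [i] attains its minimum. *)
have tp i j : i != j -> dbl i j \in S -> dbl j i \in S -> t i j <= p j + t j i.
  move=> ij ijS jiS; have ji : j != i by rewrite eq_sym.
  rewrite (tE j i) // tE // [leRHS]addrC subrK.
  have [k [ik ikS Uik]] := pE i j ij ijS.
  have [ejk|jk] := eqVneq j k; first by subst k; rewrite Uik subrr U0.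
  have [l u] := fourth ij ik jk.
  have jiS' : sh (mnm1 i) j j \in S by rewrite dblE.
  have [_ S2] := loc_diag SM lS jiS' ikS.
  rewrite (omitE u) dblE dblC -/(dbl i k) in S2 *.
  by rewrite (y0 _ S2) -/(U i k) -/(U i j) -/(U j i); lra.
have tD i : full_row S i \/ forall j, t i j = 0.
  have [|[eqU _]] := rows i; [by left|right=> j]; rewrite /t.
  case: ifP => // /andP[ij ijS]; have [k [ik ikS <-]] := pE i j ij ijS.
  by rewrite /U (eqU j k) // subrr.
pose e i := if dbl i i \in S then U i i - 2 * p i - \sum_l t i l else 0.
(* When [j] attains the minimum of a full row, the two other entries add up to
   [2 * p i + \sum_l t i l], which the diagonal inequality against [omit j] bounds by [U i i]. *)
have e0 i : 0 <= e i.
  rewrite /e; case: ifP => // iiS.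
  have [D|[_]] := rows i; last by rewrite iiS.
  have [j0 ij0] : exists j0 : 'I_4, i != j0.
    by have [j] := @exists_notin [:: i] isT; rewrite inE eq_sym; exists j.
  have Dij j : i != j -> dbl i j \in S /\ omit j \in S.
    by rewrite eq_sym; exact: D.
  have [j [ij ijS Uij]] := pE i j0 ij0 (Dij j0 ij0).1.
  have [k] := @exists_notin [:: i; j] isT; rewrite !inE negb_or => /andP[ki kj].
  have ik : i != k by rewrite eq_sym.
  have jk : j != k by rewrite eq_sym.
  have [l u] := fourth ij ik jk.
  have il : i != l by move: u; rewrite /= !inE !negb_or => /andP[/and3P[]].
  have u' : uniq [:: i; k; l; j].
    move: u; rewrite /= !inE !negb_or !andbT => /and3P[/and3P[-> -> ->] /andP[jk' jl] ->].
    by rewrite (eq_sym k j) (eq_sym l j) jk' jl.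
  have klS : sh (mnm1 i) k l \in S by rewrite (omitE u') (Dij j ij).2.
  have [_ _] := loc_diag SM lS iiS klS.
  rewrite (omitE u') (y0 _ (Dij j ij).2) -!/(dbl _ _) -!/(U _ _).
  rewrite (big4 _ u) tii (tE i j) // (tE i k) ?(Dij k ik).1 //.
  by rewrite (tE i l) ?(Dij l il).1 // Uij; lra.
pose b i j := Num.min (t i j) (t j i).
pose r i j := t i j - b i j.
have bt i j : b i j <= t i j by rewrite /b ge_min lexx.
have b0 i j : 0 <= b i j by rewrite /b le_min !t0.
have bC i j : b i j = b j i by rewrite /b minC.
have r0 i j : 0 <= r i j by rewrite subr_ge0.
(* This is why the piece of column [j] must also carry [p j]. *)
have rp i j : i != j -> dbl i j \in S -> dbl j i \in S -> r i j <= p j.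
  move=> ij ijS jiS; have := tp i j ij ijS jiS; rewrite /r /b minElt.
  by have := p0 j; case: ifP; lra.
have bD i j : full_row S i \/ b i j = 0.
  have [|t00] := tD i; [by left|right].
  by apply/eqP; rewrite eq_le b0 andbT -(t00 j).
have rD i j : full_row S i \/ r i j = 0.
  have [|t00] := tD i; [by left|right].
  by apply/eqP; rewrite eq_le r0 andbT -(t00 j) /r lerBlDr lerDl.
have trop_ge0 := BR_trop SM wB.
pose P1 k i : R := (i == k)%:R * p k.
pose T1 k i j : R := (j == k)%:R * r i k.
pose T2 (ac : 'I_4 * 'I_4) i j : R :=
  (((i == ac.1) && (j == ac.2)) || ((i == ac.2) && (j == ac.1)))%:R * b ac.1 ac.2.
have M1 k : 0 <= pair w (cubic (layered (P1 k) (T1 k) (fun=> 0))).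
  apply: trop_ge0; apply: layered_trop => //.
  - by move=> i; rewrite mulr_ge0.
  - by move=> i j; rewrite mulr_ge0.
  - move=> i j l jl; rewrite /T1.
    have [ejk|_] := eqVneq j k; last by left; rewrite mul0r.
    by right; rewrite (_ : l == k = false) ?mul0r // -ejk eq_sym (negbTE jl).
  - move=> i j ij ijS jiS; rewrite /T1 /P1.
    apply: le_trans (_ : (j == k)%:R * p k <= _); last by rewrite lerDl mulr_ge0.
    have [ejk|_] := eqVneq j k; last by rewrite !mul0r.
    by rewrite !mul1r -ejk rp.
  - move=> i; have [|rk] := rD i k; first by left.
    by right=> j; rewrite /T1 rk mulr0.
have M2 ac : 0 <= pair w (cubic (layered (fun=> 0) (T2 ac) (fun=> 0))).
  case: ac => a c; apply: trop_ge0; apply: layered_trop => //.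
  - by move=> i j; rewrite mulr_ge0.
  - move=> i j k jk; rewrite /T2 /=.
    have [eac|ac] := eqVneq a c.
      by left; rewrite eac /b minxx tii mulr0.
    have [ij|_] := boolP ((i == a) && (j == c) || (i == c) && (j == a)); last first.
      by left; rewrite mul0r.
    right; rewrite (_ : _ || _ = false) ?mul0r //; apply/negbTE; move: ij.
    case/orP => /andP[/eqP ei /eqP ej]; subst i j; rewrite negb_or !negb_and.
      by rewrite (eq_sym k c) jk (negbTE ac) orbT.
    by rewrite (eq_sym c a) ac (eq_sym k a) jk orbT.
  - move=> i j _ _ _; rewrite add0r /T2 /= le_eqVlt; apply/orP; left; apply/eqP.
    by case: (i == a); case: (j == c); case: (i == c); case: (j == a).
  - move=> i; rewrite /T2 /=; have [eia|ia] := eqVneq i a.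
      have [|bz] := bD i c; [by left|right=> j].
      by rewrite -eia bz mulr0.
    have [eic|ic] := eqVneq i c.
      have [|bz] := bD i a; [by left|right=> j].
      by rewrite bC -eic bz mulr0.
    by right=> j; rewrite mul0r.
have ME : 0 <= pair w (cubic (layered (fun=> 0) (fun _ _ => 0) e)).
  apply: trop_ge0; apply: layered_trop => // [i j k _|i j _ _ _|i].
  - by left.
  - by rewrite addr0.
  - by right.
have X1 := @pair_layered_ge0_sum w _ (index_enum 'I_4) 1 P1 T1 ler01 M1.
(* Ordered pairs count each pair of indices twice. *)
have half0 : 0 <= 2^-1 :> R by rewrite invr_ge0.
have X2 := @pair_layered_ge0_sum w _ (index_enum ('I_4 * 'I_4)%type) 2^-1
  (fun _ _ => 0) T2 half0 M2.
have sumP1 i : \sum_k P1 k i = p i.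
  rewrite (bigD1 i) //= /P1 eqxx mul1r big1 ?addr0 // => k /negbTE ki.
  by rewrite eq_sym ki mul0r.
have sumT1 i j : \sum_k T1 k i j = r i j.
  rewrite (bigD1 j) //= /T1 eqxx mul1r big1 ?addr0 // => k /negbTE kj.
  by rewrite eq_sym kj mul0r.
have sumT2 i j : \sum_ac T2 ac i j = 2 * b i j.
  have [eij|ij] := eqVneq i j.
    rewrite big1 => [|[a c] _]; first by rewrite eij /b minxx tii mulr0.
    rewrite /T2 /= -eij; case: (eqVneq i a) => [<-|_]; last first.
      by rewrite andbF mul0r.
    by case: (eqVneq i c) => [<-|_]; rewrite ?mul0r // /b minxx tii mulr0.
  rewrite (bigD1 (i, j)) //= (bigD1 (j, i)) /=; last first.
    by apply: contraNneq ij => -[->].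
  rewrite big1 => [|[a c] /andP[nij nji]].
    by rewrite /T2 /= !eqxx /= orbT (bC j i) !mul1r addr0 mulr_natl.
  rewrite /T2 /= (_ : _ || _ = false) ?mul0r //; apply/negbTE; rewrite negb_or.
  apply/andP; split; apply/negP => /andP[/eqP ei /eqP ej].
    by rewrite ei ej eqxx in nij.
  by rewrite ei ej eqxx in nji.
have halfK (x : R) : 2^-1 * (2 * x) = x by rewrite mulKf ?pnatr_eq0.
suff -> : pair w nu = pair w (cubic (layered
    (fun i => 1 * (1 * \sum_k P1 k i) + (1 * (2^-1 * \sum_(ac : 'I_4 * 'I_4) 0) + 0))
    (fun i j => 1 * (1 * \sum_k T1 k i j) + (1 * (2^-1 * \sum_ac T2 ac i j) + 0))
    (fun i => 1 * 0 + (1 * 0 + e i)))).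
  by rewrite !pair_layered !mul1r !addr_ge0.
apply: eq_pair => a aS; rewrite (_ : nu a = cubic U a).
  rewrite /cubic; apply: eq_bigr => i _; apply: eq_bigr => j _.
  have [eij|_] := eqVneq a (dbl i j); last by rewrite !mul0r.
  congr (_ * _); rewrite eij in aS; have [ij|ij] := eqVneq i j.
    subst j; rewrite layered_diag sumP1 big1 // /e aS.
    under [X in _ = _ + X + _]eq_bigr do
      rewrite sumT1 sumT2 halfK !mul1r addr0 subrK.
    by rewrite !mulr0 !mul1r; ring.
  rewrite layered_off // sumP1 sumT1 sumT2 big1 // halfK /r.
  by rewrite !mulr0 !mul1r !addr0 subrK tE // addrC subrK.
have [[i [j ea]]|[l el]] := mem_Delta43 SM aS.
  by rewrite ea cubic_dbl.
by rewrite el cubic_omit y0 // -el.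
Qed.

End Splitting.

Section FourThreeCone.
Variables (R : realType) (S : {fset multinom 4}).
Hypothesis SM : Mconvex 3 S.
Implicit Types (nu : multinom 4 -> R) (i j k l m : 'I_4).

Lemma lin_mnm1 (c : 'I_4 -> R) i : lin c (mnm1 i) = c i.
Proof.
rewrite /lin (bigD1 i) //= mnm1E eqxx mulr1 big1 ?addr0 // => j /negbTE ji.
by rewrite mnm1E eq_sym ji mulr0.
Qed.

Lemma lin_dbl (c : 'I_4 -> R) i j : lin c (dbl i j) = 2 * c i + c j.
Proof. by rewrite lin_sh lin_mnm1; ring. Qed.

Lemma lin_omit (c : 'I_4 -> R) l : lin c (omit l) = \sum_i c i - c l.
Proof.
rewrite /lin (bigD1 l) //= mnmE eqxx mulr0 add0r [in RHS](bigD1 l) //= [RHS]addrC addKr.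
by apply: eq_bigr => i; rewrite mnmE => ->; rewrite mulr1.
Qed.

Lemma full_rowP i j k l : uniq [:: i; j; k; l] ->
  sh (mnm1 i) i j \in S -> sh (mnm1 i) k l \in S ->
  sh (mnm1 i) i k \in S -> sh (mnm1 i) j l \in S ->
  sh (mnm1 i) i l \in S -> sh (mnm1 i) j k \in S -> full_row S i.
Proof.
move=> u ij kl ik jl il jk m mi.
have u1 := uniq4_swap34 (uniq4_swap23 u).
have u2 := uniq4_swap34 u.
have := uniq4_in m u; rewrite !inE (negbTE mi) /= => /or3P[] /eqP ->.
- by rewrite -(omitE u1).
- by rewrite -(omitE u2).
- by rewrite -(omitE u).
Qed.

Lemma trop_no_full_row nu : loc S nu -> (forall m, ~ full_row S m) -> trop S nu.
Proof.
move=> lS nof; apply: (trop_of_loc SM lS) => b i j k l u ij kl ik jl il jk.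
have [m bm] : exists m, b = mnm1 m.
  have : mdeg b = 1%N.
    have [_ /fsubsetP/(_ _ ij)] := SM; rewrite in_Delta mdeg_sh => /eqP.
    by lia.
  by move/eqP/mdeg1P => [m /eqP ->]; exists m.
exfalso; subst b; have := uniq4_in m u; rewrite !inE => /or4P[] /eqP em; subst m.
- by apply: (nof i); exact: (full_rowP u).
- apply: (nof j); apply: (@full_rowP j i l k) => //; rewrite 1?shC //.
  exact: (uniq4_swap34 (uniq4_swap12 u)).
- apply: (nof k); apply: (@full_rowP k l i j) => //; rewrite 1?shC //.
  exact: (uniq4_swap23 (uniq4_swap34 (uniq4_swap12 (uniq4_swap23 u)))).
- apply: (nof l); apply: (@full_rowP l k j i) => //; rewrite 1?shC //.
  apply: uniq4_swap34; apply: uniq4_swap12.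
  exact: (uniq4_swap23 (uniq4_swap34 (uniq4_swap12 (uniq4_swap23 u)))).
Qed.

(** For [i != j] and [l] the fourth index, exchanging [2 e_i] against [e_m + e_l] at [e_j] would put
    [omit m] into [S]. If [3 e_i] were present, an exchange at [e_i] would give such a [dbl i j]. *)
Lemma dbl_notin m i j : full_row S m -> omit m \notin S -> i != m -> j != m ->
  dbl i j \notin S.
Proof.
move=> D om; have mdb i' j' : i' != m -> j' != m -> i' != j' -> dbl i' j' \notin S.
  move=> im jm ij; apply: contraNN om => ijS.
  have ji : j' != i' by rewrite eq_sym.
  have mi : m != i' by rewrite eq_sym.
  have mj : m != j' by rewrite eq_sym.
  have [l u] := fourth jm ji mi.
  have u1 := uniq4_swap34 u.
  have u2 := uniq4_swap34 (uniq4_swap23 u).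
  have ml : sh (mnm1 j') m l \in S by rewrite (omitE u1); have [] := D i' im.
  rewrite -dblE in ijS.
  by have := Mconvex_exchange SM ijS ml; rewrite (omitE u2) => /orP[]/andP[].
move=> im jm; have [eij|] := eqVneq i j; last exact: mdb.
subst j; apply/negP => iiS.
have [j] := @exists_notin [:: i; m] isT; rewrite !inE negb_or => /andP[ji jm'].
have mi : m != i by rewrite eq_sym.
have ij : i != j by rewrite eq_sym.
have mj : m != j by rewrite eq_sym.
have [l u] := fourth im ij mj.
have lm : l != m.
  by move: u; rewrite /= !inE !negb_or !andbT (eq_sym l) => /and3P[_ /andP[]].
have mjS : sh (mnm1 i) m j \in S by rewrite (omitE u); have [] := D l lm.
have ijS := mdb i j im jm' ij.
by have := Mconvex_exchange SM iiS mjS; rewrite -!/(dbl _ _) (negbTE ijS) andbF.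
Qed.

(* A linear function is subtracted so that the square-free values vanish; when
   [omit m] is missing, [S] lies in [{a | a m >= 1}] and one more degree of
   freedom makes the row [m] nonnegative. *)
Lemma pair_ge0_43 nu (w : {ffun S -> R^o}) : BR R 3 S w -> loc S nu ->
  0 <= pair w nu.
Proof.
move=> wB lS.
have [[m D]|/forallNP nof] := pselect (exists m, full_row S m); last first.
  exact: (BR_trop SM wB (trop_no_full_row lS nof)).
suff [c [y0 U0 rows]] : exists c : 'I_4 -> R,
  [/\ forall l, omit l \in S -> nu (omit l) = lin c (omit l),
  forall i j, i != j -> dbl i j \in S -> 0 <= nu (dbl i j) - lin c (dbl i j)
  & forall i, full_row S i \/
    (forall j k, i != j -> i != k -> dbl i j \in S -> dbl i k \in S ->
      nu (dbl i j) - lin c (dbl i j) = nu (dbl i k) - lin c (dbl i k)) /\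
      dbl i i \notin S].
  have -> : pair w nu = pair w (lin c) + pair w (fun a => nu a - lin c a).
    by rewrite -pairDr; apply: eq_pair => a _; rewrite addrC subrK.
  rewrite addr_ge0 //; first exact: (BR_trop SM wB (trop_lin SM c)).
  apply: (pair_decomp SM wB) => //; first exact: loc_lin.
  by move=> l /y0 ->; rewrite subrr.
(* The diagonal inequality for [2 e_i] at [e_j] compares [dbl i j] with three square-free values,
   all 0. *)
have U_ge0 (nu' : multinom 4 -> R) i j : loc S nu' ->
    (forall l, omit l \in S -> nu' (omit l) = 0) -> i != j -> omit i \in S ->
    dbl i j \in S -> 0 <= nu' (dbl i j).
  move=> lS' y0 ij oi ijS; have [k] := @exists_notin [:: i; j] isT.
  rewrite !inE negb_or => /andP[ki kj].
  have ji : j != i by rewrite eq_sym.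
  have jk : j != k by rewrite eq_sym.
  have ik : i != k by rewrite eq_sym.
  have [l u] := fourth ji jk ik.
  have u1 := uniq4_swap34 (uniq4_swap23 u).
  have u2 := uniq4_swap34 u.
  rewrite -dblE in ijS *; rewrite -(omitE u1) in oi.
  have [s1 s2] := loc_diag SM lS' ijS oi.
  rewrite (omitE u) in s1 *; rewrite (omitE u2) in s2 *.
  by rewrite (omitE u1) in oi *; rewrite !y0 //; lra.
have [om|om] := boolP (omit m \in S).
  have oS l : omit l \in S.
    by have [->|lm] := eqVneq l m; [|have [] := D l lm].
  (* The equations are [\sum_i c i - c l = nu (omit l)]; summed over [l], they give
     [\sum_i c i = s]. *)
  pose s := (\sum_l nu (omit l)) / 3.
  pose c l := s - nu (omit l).
  have cO l : lin c (omit l) = nu (omit l).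
    rewrite lin_omit /c sumrB sumr_const card_ord -mulr_natl /s; by field.
  have y0 l : omit l \in S -> nu (omit l) - lin c (omit l) = 0.
    by rewrite cO subrr.
  exists c; split=> [l _|i j ij ijS|i]; first by rewrite cO.
    exact: (U_ge0 _ i j (loc_lin c lS)).
  have [|nD] := pselect (full_row S i); [by left|right].
  have [j0 [ij0 j0S]] : exists j0, i != j0 /\ dbl i j0 \notin S.
    apply: contrapT => h; apply: nD => j ji; split=> //.
    by apply/negPn/negP => jS; apply: h; exists j; rewrite eq_sym.
  (* The missing [dbl i j0] makes the condition at [e_i] linear; used both ways, it equates the
     present entries of the row. *)
  have half j k : i != j -> i != k -> dbl i j \in S -> dbl i k \in S -> j != k ->
      nu (dbl i k) - lin c (dbl i k) <= nu (dbl i j) - lin c (dbl i j).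
    move=> ij ik ijS ikS jk.
    have jj0 : j != j0 by apply: contraNneq j0S => <-.
    have kj0 : k != j0 by apply: contraNneq j0S => <-.
    have u : uniq [:: i; j; k; j0].
      by rewrite /= !inE !negb_or ij ik ij0 jk jj0 kj0.
    have u1 := uniq4_swap34 (uniq4_swap23 u).
    have u2 := uniq4_swap34 u.
    have := loc_lin c lS (b := mnm1 i) (i := i) (j := j) (k := k) (l := j0).
    rewrite /gen_cond -!/(dbl _ _) (omitE u1) (omitE u2) !oS ijS ikS (negbTE j0S).
    by rewrite /= orbT => /(_ isT); rewrite !(y0 _ (oS _)) !addr0.
  split=> [j k ij ik ijS ikS|].
    have [-> //|jk] := eqVneq j k; have kj : k != j by rewrite eq_sym.
    by apply/eqP; rewrite eq_le !half.
  apply: contraNN j0S => iiS; have [k] := @exists_notin [:: i; j0] isT.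
  rewrite !inE negb_or => /andP[ki kj].
  have ik : i != k by rewrite eq_sym.
  have jk : j0 != k by rewrite eq_sym.
  have [l u] := fourth ij0 ik jk.
  have jkS : sh (mnm1 i) j0 k \in S by rewrite (omitE u).
  by have [] := loc_diag SM lS iiS jkS.
have oS l : l != m -> omit l \in S by move=> lm; have [] := D l lm.
pose s := \sum_(l | l != m) nu (omit l).
(* The three equations with [l != m] leave [z] free. It enters the off-diagonal entries of row [m]
   with coefficient 1, so this value makes them nonnegative. *)
pose z := 2 * `|s| + \sum_j (`|nu (dbl m j)| + `|nu (omit j)|).
pose c l := if l == m then s - 2 * (z / 3) else z / 3 - nu (omit l).
have cm : c m = s - 2 * (z / 3) by rewrite /c eqxx.
have cl l : l != m -> c l = z / 3 - nu (omit l) by rewrite /c => /negbTE ->.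
have sumc : \sum_l c l = z / 3.
  rewrite (bigD1 m) //= cm (eq_bigr (fun l => z / 3 - nu (omit l))) //.
  rewrite sumrB -/s sumr_const (_ : #|_| = 3%N); first by rewrite -mulr_natl; field.
  by have := cardC1 m; rewrite card_ord.
have cO l : l != m -> lin c (omit l) = nu (omit l).
  by move=> lm; rewrite lin_omit sumc cl //; ring.
have y0 l : omit l \in S -> nu (omit l) - lin c (omit l) = 0.
  have [->|lm _] := eqVneq l m; first by rewrite (negbTE om).
  by rewrite cO ?subrr.
exists c; split=> [l lS'|i j ij ijS|i].
- by rewrite cO //; apply: contraNneq om => <-.
- have [eim|im] := eqVneq i m; last first.
    exact: (U_ge0 _ i j (loc_lin c lS) y0 ij (oS i im)).
  subst i; have jm : j != m by rewrite eq_sym.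
  rewrite lin_dbl cm cl //.
  have : `|nu (dbl m j)| + `|nu (omit j)| <=
      \sum_j (`|nu (dbl m j)| + `|nu (omit j)|).
    by rewrite (bigD1 j) //= lerDl sumr_ge0 // => k _; rewrite addr_ge0.
  have := ler_norm s; have := ler_norm (- nu (dbl m j)).
  have := ler_norm (- nu (omit j)); rewrite !normrN /z.
  by move: (\sum_j _) => Z; lra.
- have [->|im] := eqVneq i m; [by left|right]; split; last exact: (dbl_notin D).
  move=> j k _ _ ijS ikS; suff h q : dbl i q \in S -> q = m.
    by rewrite (h j) // (h k).
  move=> iqS; apply/eqP; apply: contraTT iqS => qm; exact: (dbl_notin D).
Qed.

End FourThreeCone.

Lemma BR_eq_Cone_of_cases (R : realType) n d (S : {fset multinom n}) :
  [\/ (n <= 3)%N, d = 2%N | n = 4%N /\ d = 3%N] -> Mconvex d S ->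
  BR R d S = Cone (local_gens R d S).
Proof.
case=> [n3 SM|d2 SM|[n4 d3]]; last 1 first.
- by subst n d => SM; apply: BR_eq_Cone => // w wB nu; exact: pair_ge0_43.
- apply: BR_eq_Cone => // w wB nu lS; exact: (BR_trop SM wB (loc_le3 SM n3 lS)).
- by subst d; exact: BR_eq_Cone_deg2.
Qed.

(** * Strict inclusion for full support *)

Section FullSupport.
Variables (R : realType) (n d : nat).
Implicit Types (nu h : multinom n -> R) (b g : multinom n).

Lemma Mconvex_Delta : (1 <= n)%N -> Mconvex d (Delta n d).
Proof.
move=> n1; split=> [||a b i].
- apply/fset0Pn; exists (Multinom [tuple (i == Ordinal n1) * d | i < n])%N.
  rewrite in_Delta mdegE (bigD1 (Ordinal n1)) //= mnmE eqxx mul1n big1 ?addn0 //.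
  by move=> i /negbTE ni; rewrite mnmE ni.
- exact: fsubset_refl.
rewrite !in_Delta => /eqP ad /eqP bd ba.
have [j aj] : exists j, (a j < b j)%N.
  apply/existsP; apply: contraT => /existsPn h.
  have : (\sum_k b k < \sum_k a k)%N.
    rewrite (bigD1 i) //= [ltnRHS](bigD1 i) //= -addSn leq_add //.
    by apply: leq_sum => k _; rewrite leqNgt.
  by rewrite -!mdegE ad bd ltnn.
exists j; rewrite !in_Delta aj; split=> //.
  rewrite -(eqn_add2r (mdeg (mnm1 i))) -mdegD.
  have -> : (a - 'e_i + 'e_j + 'e_i)%mnm = (a + 'e_j)%mnm.
    apply/mnmP => k; rewrite !mnmDE !mnmBE !mnm1E.
    by case: (eqVneq i k) => [<-|_]; lia.
  by rewrite mdegD ad !mdeg1.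
rewrite -(eqn_add2r (mdeg (mnm1 j))) -mdegD.
have -> : (b - 'e_j + 'e_i + 'e_j)%mnm = (b + 'e_i)%mnm.
  apply/mnmP => k; rewrite !mnmDE !mnmBE !mnm1E.
  by case: (eqVneq j k) => [<-|_]; lia.
by rewrite mdegD bd !mdeg1.
Qed.

Lemma Cone_local_gens_notin (w : {ffun Delta n d -> R^o}) nu :
  (forall b (v : {ffun Sloc (Delta n d) b -> R^o}), (mdeg b + 2)%N = d ->
    BR R 2 (Sloc (Delta n d) b) v -> 0 <= pair v (fun g => nu (b + g)%mnm)) ->
  pair w nu < 0 -> ~ Cone (local_gens R d (Delta n d)) w.
Proof.
move=> h w0 [m [u [c [uE c0 we]]]]; move: w0; rewrite we pair_suml ltNge.
move/negP; apply; apply: sumr_ge0 => i _; rewrite pairZl mulr_ge0 //.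
by have [b [v [bd _ vB ->]]] := uE i; rewrite pair_lift_loc; exact: h.
Qed.

(* The larger of the two other products of Hessian entries dominates
   [c_ij * c_kl] up to the factor [expR C]; Lorentzian polynomials have
   [C = ln 4], see [logc_four_point]. *)
Definition almost_trop (C : R) nu : Prop := forall b i j k l,
  (mdeg b + 2)%N = d -> nu (sh b i k) + nu (sh b j l) <=
    nu (sh b i l) + nu (sh b j k) ->
  nu (sh b i k) + nu (sh b j l) <= nu (sh b i j) + nu (sh b k l) + C.

Lemma BR_almost_trop (w : {ffun Delta n d -> R^o}) (D : R) : (1 <= n)%N ->
  (forall C nu, 0 <= C -> almost_trop C nu -> - (D * C) <= pair w nu) ->
  BR R d (Delta n d) w.
Proof.
move=> n1 h; apply/BR_lower; exists (D * ln 4) => f fL; apply: h.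
  by rewrite ln_ge0 // ler1n.
move=> b i j k l bd le; have inD p q : sh b p q \in Delta n d.
  by rewrite in_Delta mdeg_sh bd.
exact: (logc_four_point (Mconvex_Delta n1) fL).
Qed.

Lemma almost_trop_diag (C : R) nu b i k l : almost_trop C nu ->
  (mdeg b + 2)%N = d ->
  nu (sh b i k) + nu (sh b i l) <= nu (sh b i i) + nu (sh b k l) + C.
Proof. by move=> h bd; apply: h => //; rewrite addrC. Qed.

Lemma almost_trop_four (C : R) nu b i j k l : almost_trop C nu ->
  (mdeg b + 2)%N = d ->
  nu (sh b i k) + nu (sh b j l) <= nu (sh b i j) + nu (sh b k l) + C \/
  nu (sh b i l) + nu (sh b j k) <= nu (sh b i j) + nu (sh b k l) + C.
Proof.
move=> h bd; have [le|/ltW le] := leP (nu (sh b i k) + nu (sh b j l))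
  (nu (sh b i l) + nu (sh b j k)); [left; exact: h|right].
by rewrite (shC b k l); apply: h.
Qed.

End FullSupport.

(** * Functions nonnegative on all local bounded ratios *)

Section LocalCuts.
Variables (R : realType) (n d : nat) (b : multinom n).
Hypotheses (n1 : (1 <= n)%N) (bd : (mdeg b + 2)%N = d).
Local Notation T := (Sloc (Delta n d) b).
Implicit Types (h : multinom n -> R) (g : multinom n) (A : {set 'I_n}).

(** The dual cone of the local bounded ratios. Unlike the tropical functions that it contains, it is
    closed under sums. *)
Definition dualpos h : Prop := forall v : {ffun T -> R^o}, BR R 2 T v ->
  0 <= pair v h.

Definition wt A g : nat := \sum_(i in A) g i.

Definition dist (x y : nat) : nat := (x - y) + (y - x).

Lemma in_T g : (g \in T) = (mdeg g == 2%N).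
Proof.
rewrite in_Sloc in_Delta mdegD -bd eqn_add2l andbb.
by [].
Qed.

Lemma Mconvex_T : Mconvex 2 T.
Proof.
apply: Mconvex_Sloc (Mconvex_Delta d n1) _; apply/fset0Pn.
by exists (sh mnm0 (Ordinal n1) (Ordinal n1)); rewrite in_T mdeg_sh mdeg0.
Qed.

Lemma eq_dualpos h h' : (forall g, mdeg g = 2%N -> h g = h' g) ->
  dualpos h' -> dualpos h.
Proof.
move=> e hh v vB; rewrite (@eq_pair _ _ _ _ _ h') ?hh // => g.
by rewrite in_T => /eqP/e.
Qed.

Lemma dualposD h h' : dualpos h -> dualpos h' -> dualpos (fun g => h g + h' g).
Proof. by move=> hh hh' v vB; rewrite pairDr addr_ge0 ?hh ?hh'. Qed.

Lemma dualpos_trop h : trop T h -> dualpos h.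
Proof. by move=> hT v vB; exact: (BR_trop Mconvex_T vB hT). Qed.

Lemma dualpos_lin c : dualpos (lin c : multinom n -> R).
Proof. exact/dualpos_trop/(trop_lin Mconvex_T). Qed.

Lemma dualpos_wt A (x y : R) : dualpos (fun g => x * (wt A g)%:R + y).
Proof.
(* In degree 2 the constant [y] is [y / 2] times the degree. *)
apply: (@eq_dualpos _ (lin (fun i => x * (i \in A)%:R + y / 2))).
  move=> g g2; rewrite /lin; under eq_bigr do rewrite mulrDl.
  rewrite big_split /= -mulr_sumr -natr_sum -mdegE g2 divfK ?pnatr_eq0 //.
  congr (_ + _); rewrite /wt natr_sum big_mkcond mulr_sumr /=.
  by apply: eq_bigr => i _; case: ifP => _; rewrite ?mulr1 ?mulr0 ?mul0r.
exact: dualpos_lin.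
Qed.

Lemma wt_sh A i j : wt A (sh mnm0 i j) = ((i \in A) + (j \in A))%N.
Proof.
rewrite /wt; under eq_bigr do rewrite shE mnm0E add0n.
have delta p : (\sum_(r in A) (p == r) = (p \in A))%N.
  have [pA|pA] := boolP (p \in A); last first.
    by rewrite big1 // => r rA; case: eqP pA => // ->; rewrite rA.
  rewrite (bigD1 p) //= eqxx big1 ?addn0 // => r /andP[_ /negbTE].
  by rewrite eq_sym => ->.
by rewrite big_split /= !delta.
Qed.

Lemma wt_le2 A g : mdeg g = 2%N -> (wt A g <= 2)%N.
Proof. by move=> <-; rewrite mdegE /wt [leqRHS](bigID (mem A)) /= leq_addr. Qed.

(** At [e_i + e_j] the value is 0 if [A] separates [i] from [j] and 1 otherwise: one minus the split
    metric of [A], which is a tree metric. *)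
Lemma dualpos_cut A : dualpos (fun g => (dist (wt A g) 1)%:R).
Proof.
apply: dualpos_trop => b0 i j k l; rewrite !in_T !mdeg_sh.
rewrite -[X in _ == X]/(0 + 2)%N eqn_add2r mdeg_eq0 => /eqP -> _.
rewrite !wt_sh -!natrD.
have /orP[le|le] :
    (dist ((i \in A) + (k \in A)) 1 + dist ((j \in A) + (l \in A)) 1 <=
      dist ((i \in A) + (j \in A)) 1 + dist ((k \in A) + (l \in A)) 1)%N ||
    (dist ((i \in A) + (l \in A)) 1 + dist ((j \in A) + (k \in A)) 1 <=
      dist ((i \in A) + (j \in A)) 1 + dist ((k \in A) + (l \in A)) 1)%N.
- by case: (i \in A); case: (j \in A); case: (k \in A); case: (l \in A).
- by left; split; rewrite // ler_nat.
- by right; split; rewrite // ler_nat.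
Qed.

(** The weight takes values in [{0, 1, 2}], so the function is affine in it unless the kink is at
    weight 1, where it is the cut. *)
Lemma dualpos_dist A (x c : nat) : dualpos (fun g => (dist (x + wt A g) c)%:R).
Proof.
have [cx|xc] := leqP c x.
  apply: eq_dualpos (dualpos_wt A 1 (x - c)%:R) => g _.
  by rewrite mul1r -natrD /dist; congr _%:R; lia.
have [x2|x2] := leqP (x + 2) c.
  apply: eq_dualpos (dualpos_wt A (-1) (c - x)%:R) => g /(@wt_le2 A) g2.
  rewrite mulN1r addrC -natrB /dist; last by lia.
  by congr _%:R; lia.
apply: eq_dualpos (dualpos_cut A) => g _; rewrite /dist; congr _%:R; lia.
Qed.

End LocalCuts.

Section Coordinates.
Variables (n : nat) (i1 i2 i3 i4 i5 : 'I_n).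
Implicit Types a b c d e : nat.

(** Written as a sum so that indices may coincide: with four variables, [i1] is repeated as an idle
    fifth index of exponent 0. *)
Definition expo a b c d e : multinom n :=
  Multinom [tuple ((i1 == i) * a + (i2 == i) * b + (i3 == i) * c +
    (i4 == i) * d + (i5 == i) * e)%N | i < n].

Lemma expo1 a b c d e : (expo a b c d e + mnm1 i1)%mnm = expo a.+1 b c d e.
Proof. by apply/mnmP => i; rewrite mnmDE mnm1E !mnmE; case: (i1 == i); lia. Qed.

Lemma expo2 a b c d e : (expo a b c d e + mnm1 i2)%mnm = expo a b.+1 c d e.
Proof. by apply/mnmP => i; rewrite mnmDE mnm1E !mnmE; case: (i2 == i); lia. Qed.

Lemma expo3 a b c d e : (expo a b c d e + mnm1 i3)%mnm = expo a b c.+1 d e.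
Proof. by apply/mnmP => i; rewrite mnmDE mnm1E !mnmE; case: (i3 == i); lia. Qed.

Lemma expo4 a b c d e : (expo a b c d e + mnm1 i4)%mnm = expo a b c d.+1 e.
Proof. by apply/mnmP => i; rewrite mnmDE mnm1E !mnmE; case: (i4 == i); lia. Qed.

Lemma expo5 a b c d e : (expo a b c d e + mnm1 i5)%mnm = expo a b c d e.+1.
Proof. by apply/mnmP => i; rewrite mnmDE mnm1E !mnmE; case: (i5 == i); lia. Qed.

Lemma mdeg_expo a b c d e : mdeg (expo a b c d e) = (a + b + c + d + e)%N.
Proof.
have delta (p : 'I_n) m : (\sum_i (p == i) * m)%N = m.
  rewrite (bigD1 p) //= eqxx mul1n big1 ?addn0 // => i /negbTE.
  by rewrite eq_sym => ->.
by rewrite mdegE; under eq_bigr do rewrite mnmE; rewrite !big_split /= !delta.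
Qed.

End Coordinates.

Section Combinations.
Variables (R : realType) (n : nat) (S : {fset multinom n}).

Definition comb (s : seq (R * multinom n)) : {ffun S -> R^o} :=
  \sum_(x <- s) x.1 *: eps R S x.2.

Lemma pair_comb s nu : all (fun x => x.2 \in S) s ->
  pair (comb s) nu = \sum_(x <- s) x.1 * nu x.2.
Proof.
move=> /allP sS; rewrite pair_suml !big_seq; apply: eq_bigr => x xs.
by rewrite pairZl pair_eps ?sS.
Qed.

End Combinations.

Lemma wt_set2 n (i j : 'I_n) (g : multinom n) : i != j ->
  wt [set i; j] g = (g i + g j)%N.
Proof. by move=> ij; rewrite /wt big_setU1 ?inE //= big_set1. Qed.

Lemma wt_set3 n (i j k : 'I_n) (g : multinom n) : i != j -> i != k -> j != k ->
  wt [set i; j; k] g = (g i + g j + g k)%N.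
Proof.
move=> ij ik jk; rewrite /wt finset.setUC big_setU1 /=; last first.
  by rewrite !inE negb_or !(eq_sym k) ik.
by rewrite -/(wt [set i; j] g) wt_set2 // addnC.
Qed.

Ltac norm_natmul := repeat match goal with |- context [Algebra.natmul _ ?x] =>
  let v := eval vm_compute in x in
  tryif constr_eq x v then fail else change x with v end.

(** * The gap for at least four variables and degree at least four *)

Section GapFour.
Variables (R : realType) (n k : nat) (i1 i2 i3 i4 : 'I_n).
Hypotheses (n12 : i1 != i2) (n13 : i1 != i3) (n14 : i1 != i4).
Hypotheses (n23 : i2 != i3) (n24 : i2 != i4) (n34 : i3 != i4).
Local Notation d := k.+4.
Local Notation a4 a b c e := (expo i1 i2 i3 i4 i1 a b c e 0).

(* The ratio is [2 (s - s1) + L1 = 2 (s - s2) + L2], where [s1], [s2], [s] are the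
   three sums of the four-point condition at [e_1 + k e_2 + e_4] and [L1], [L2]
   are sums of local inequalities on diagonal entries. *)
Definition ratio4 : {ffun Delta n d -> R^o} := comb (Delta n d)
  [:: (-1, a4 2 k.+1 1 0); (1, a4 2 k 2 0); (-1, a4 2 k 1 1); (2, a4 2 k 0 2);
      (-1, a4 1 k.+2 0 1); (1, a4 1 k.+1 2 0); (-1, a4 1 k.+1 0 2);
      (-1, a4 1 k 2 1); (2, a4 0 k.+3 1 0); (-2, a4 0 k.+2 2 0);
      (-1, a4 0 k.+2 1 1); (1, a4 0 k.+2 0 2); (2, a4 0 k.+1 2 1);
      (-1, a4 0 k.+1 1 2)].

(* [x], [y], [z] are the coordinates [a_1], [a_3], [a_4]. *)
Definition bump4 (x y z : nat) : nat :=
  dist (y + z) 2 + dist (x + y) 2 + 2 * [&& x == 0, z == 0 & y == 2].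

Definition nu4 (a : multinom n) : R := (bump4 (a i1) (a i3) (a i4))%:R.

Let n1 : (1 <= n)%N. Proof. by case: (n) i1 => [[]|]. Qed.

Lemma pair_ratio4 nu : pair ratio4 nu =
  - nu (a4 2 k.+1 1 0) + nu (a4 2 k 2 0) - nu (a4 2 k 1 1) + 2 * nu (a4 2 k 0 2)
  - nu (a4 1 k.+2 0 1) + nu (a4 1 k.+1 2 0) - nu (a4 1 k.+1 0 2)
  - nu (a4 1 k 2 1) + 2 * nu (a4 0 k.+3 1 0) - 2 * nu (a4 0 k.+2 2 0)
  - nu (a4 0 k.+2 1 1) + nu (a4 0 k.+2 0 2) + 2 * nu (a4 0 k.+1 2 1)
  - nu (a4 0 k.+1 1 2).
Proof.
rewrite /ratio4 pair_comb; first by rewrite !big_cons big_nil /=; lra.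
by rewrite /= !in_Delta !mdeg_expo; apply/andP; do ?[split]; lia.
Qed.

Lemma ratio4_BR : BR R d (Delta n d) ratio4.
Proof.
(* The constant 8 counts the four-point condition twice and six diagonal inequalities: the five
   listed, with [e3], respectively [f3], used twice. *)
apply: (@BR_almost_trop _ _ _ _ 8 n1) => C nu C0 h.
have diag b i j l : (mdeg b + 2)%N = d ->
    nu (sh b i j) + nu (sh b i l) <= nu (sh b i i) + nu (sh b j l) + C.
  exact: almost_trop_diag.
have bd a j c e : (a + j + c + e)%N = 2%N -> (mdeg (a4 a (j + k) c e) + 2)%N = d.
  by rewrite mdeg_expo; lia.
have e1 := diag (a4 2 k 0 0) i3 i2 i4 (bd 2 0 0 0 erefl).
have e2 := diag (a4 1 k 1 0) i4 i2 i3 (bd 1 0 1 0 erefl).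
have e3 := diag (a4 0 k.+1 1 0) i2 i3 i4 (bd 0 1 1 0 erefl).
have e4 := diag (a4 0 k.+1 0 1) i1 i2 i3 (bd 0 1 0 1 erefl).
have e5 := diag (a4 0 k 0 2) i2 i1 i3 (bd 0 0 0 2 erefl).
have f1 := diag (a4 1 k 1 0) i2 i1 i4 (bd 1 0 1 0 erefl).
have f2 := diag (a4 0 k.+2 0 0) i4 i1 i3 (bd 0 2 0 0 erefl).
have f3 := diag (a4 0 k.+1 1 0) i2 i1 i3 (bd 0 1 1 0 erefl).
have f4 := diag (a4 0 k.+1 0 1) i3 i1 i4 (bd 0 1 0 1 erefl).
have f5 := diag (a4 0 k 2 0) i1 i2 i4 (bd 0 0 2 0 erefl).
have q := @almost_trop_four _ _ _ C nu (a4 1 k 0 1) i1 i4 i2 i3 h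
  (bd 1 0 0 1 erefl).
move: e1 e2 e3 e4 e5 f1 f2 f3 f4 f5 q.
rewrite /sh !(expo1, expo2, expo3, expo4) pair_ratio4.
clear -C0.
move: (nu (a4 2 k.+1 1 0)) (nu (a4 2 k 2 0)) (nu (a4 2 k 1 1)) (nu (a4 2 k 0 2))
  (nu (a4 1 k.+2 0 1)) (nu (a4 1 k.+1 2 0)) (nu (a4 1 k.+1 0 2))
  (nu (a4 1 k 2 1)) (nu (a4 0 k.+3 1 0)) (nu (a4 0 k.+2 2 0))
  (nu (a4 0 k.+2 1 1)) (nu (a4 0 k.+2 0 2)) (nu (a4 0 k.+1 2 1))
  (nu (a4 0 k.+1 1 2)) (nu (a4 2 k.+1 0 1)) (nu (a4 1 k 1 2))
  (nu (a4 1 k.+1 1 1)) (nu (a4 1 k.+2 1 0)).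
move=> *; lra.
Qed.

Lemma pair_ratio4_nu4 : pair ratio4 nu4 < 0.
Proof.
have nE a b c e : nu4 (a4 a b c e) = (bump4 a c e)%:R.
  rewrite /nu4 !mnmE !eqxx; congr (bump4 _ _ _)%:R.
  - by rewrite !(eq_sym _ i1) (negbTE n12) (negbTE n13) (negbTE n14); lia.
  - by rewrite (negbTE n13) (negbTE n23) (eq_sym i4) (negbTE n34); lia.
  - by rewrite (negbTE n14) (negbTE n24) (negbTE n34); lia.
rewrite pair_ratio4 !nE; norm_natmul; lra.
Qed.

Lemma nu4_dualpos b : (mdeg b + 2)%N = d ->
  dualpos d b (fun g => nu4 (b + g)%mnm).
Proof.
move=> bd.
have base : dualpos d b (fun g => (dist (b i3 + b i4 + wt [set i3; i4] g) 2)%:R +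
    (dist (b i1 + b i3 + wt [set i1; i3] g) 2)%:R : R).
  by apply: dualposD; apply: dualpos_dist.
have nuE g : nu4 (b + g)%mnm =
    (dist (b i3 + b i4 + wt [set i3; i4] g) 2)%:R +
    (dist (b i1 + b i3 + wt [set i1; i3] g) 2)%:R +
    (2 * [&& b i1 + g i1 == 0, b i4 + g i4 == 0 & b i3 + g i3 == 2])%N%:R.
  rewrite /nu4 /bump4 !mnmDE !wt_set2 // !natrD.
  by rewrite (addnACA (b i3) (g i3)) (addnACA (b i1) (g i1)).
have g2 g : mdeg g = 2%N -> (g i1 + g i3 + g i4 <= 2)%N.
  by move/(@wt_le2 _ [set i1; i3; i4]); rewrite wt_set3.
have [b14|] := boolP ((b i1 == 0%N) && (b i4 == 0%N)); last first.
  rewrite negb_and => b14; apply: (eq_dualpos bd _ base) => g _; rewrite nuE.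
  rewrite (_ : [&& _, _ & _] = false) ?muln0 ?addr0 //.
  by apply/negbTE; rewrite !addn_eq0; case/orP: b14 => /negbTE ->; rewrite ?andbF.
case/andP: b14 => /eqP b1 /eqP b4.
have [b3|b3] := leqP (b i3) 2; last first.
  apply: (eq_dualpos bd _ base) => g _; rewrite nuE.
  rewrite (_ : [&& _, _ & _] = false) ?muln0 ?addr0 //.
  by apply/negbTE; rewrite !negb_and; apply/orP; right; apply/orP; right; lia.
move: b3; rewrite leq_eqVlt => /orP[/eqP b3|].
  (* The bump is seen at [wt A g = 0]; its height 2 there is [|wt A g - 1| - wt A g + 1], a cut plus
     an affine function. *)
  pose A := [set i1; i3; i4].
  apply: (@eq_dualpos _ _ _ _ bd _ (fun g => (dist (b i3 + b i4 + wt [set i3; i4] g) 2)%:R +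
    (dist (b i1 + b i3 + wt [set i1; i3] g) 2)%:R +
    ((dist (wt A g) 1)%:R + (-1 * (wt A g)%:R + 1)))).
    move=> g /g2 gle; rewrite nuE b1 b3 b4; congr (_ + _ + _).
    rewrite wt_set3 //; move: (g i1) (g i3) (g i4) gle.
    by case=> [|[|[|?]]] [|[|[|?]]] [|[|[|?]]] //= _; norm_natmul; lra.
  apply: dualposD => //; apply: dualposD; last exact: dualpos_wt.
  exact: dualpos_cut.
rewrite ltnS leq_eqVlt => /orP[/eqP b3|].
  (* the crossing cuts [34] and [13] plus the bump make the cuts [1] and [4] *)
  apply: (@eq_dualpos _ _ _ _ bd _ (fun g => (dist (wt [set i1] g) 1)%:R +
    (dist (wt [set i4] g) 1)%:R)).
    move=> g /g2 gle; rewrite nuE b1 b3 b4 !wt_set2 // /wt !big_set1.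
    move: (g i1) (g i3) (g i4) gle.
    by case=> [|[|[|?]]] [|[|[|?]]] [|[|[|?]]] //= _; norm_natmul; lra.
  by apply: dualposD; exact: dualpos_cut.
rewrite ltnS leqn0 => /eqP b3.
(* Here the bump is seen at [g i3 = 2], where it is [|g i3 - 1| + g i3 - 1]. *)
apply: (@eq_dualpos _ _ _ _ bd _ (fun g => (dist (b i3 + b i4 + wt [set i3; i4] g) 2)%:R +
  (dist (b i1 + b i3 + wt [set i1; i3] g) 2)%:R +
  ((dist (wt [set i3] g) 1)%:R + (1 * (wt [set i3] g)%:R + -1)))).
  move=> g /g2 gle; rewrite nuE b1 b3 b4; congr (_ + _ + _).
  rewrite /wt big_set1; move: (g i1) (g i3) (g i4) gle.
  by case=> [|[|[|?]]] [|[|[|?]]] [|[|[|?]]] //= _; norm_natmul; lra.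
apply: dualposD => //; apply: dualposD; last exact: dualpos_wt.
exact: dualpos_cut.
Qed.

Lemma ratio4_notin : ~ Cone (local_gens R d (Delta n d)) ratio4.
Proof.
apply: Cone_local_gens_notin pair_ratio4_nu4 => b v bd; exact: nu4_dualpos.
Qed.

End GapFour.

(** * The gap for at least five variables and degree three *)

Section GapFive.
Variables (R : realType) (n : nat) (i1 i2 i3 i4 i5 : 'I_n).
Hypotheses (n12 : i1 != i2) (n13 : i1 != i3) (n14 : i1 != i4) (n15 : i1 != i5).
Hypotheses (n23 : i2 != i3) (n24 : i2 != i4) (n25 : i2 != i5).
Hypotheses (n34 : i3 != i4) (n35 : i3 != i5) (n45 : i4 != i5).
Local Notation a5 := (expo i1 i2 i3 i4 i5).

(* As for [ratio4], at [e_1], with [L1] and [L2] sums of three inequalities. *)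
Definition ratio5 : {ffun Delta n 3 -> R^o} := comb (Delta n 3)
  [:: (1, a5 3 0 0 0 0); (-1, a5 2 1 0 0 0); (-1, a5 2 0 1 0 0);
      (-1, a5 2 0 0 1 0); (1, a5 2 0 0 0 1); (1, a5 1 1 1 0 0);
      (-1, a5 0 1 1 1 0); (1, a5 0 1 1 0 1); (1, a5 0 1 0 2 0);
      (-1, a5 0 1 0 1 1); (1, a5 0 0 1 2 0); (-1, a5 0 0 1 1 1)].

Definition bump5 (x2 x3 x4 x5 : nat) : nat :=
  dist (x4 + x5) 1 + dist (x3 + x5) 1 + dist (x2 + x5) 1 +
  2 * [&& x2 == 1, x3 == 1 & x4 == 1].

Definition nu5 (a : multinom n) : R := (bump5 (a i2) (a i3) (a i4) (a i5))%:R.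

Let n1 : (1 <= n)%N. Proof. by case: (n) i1 => [[]|]. Qed.

Lemma pair_ratio5 nu : pair ratio5 nu =
  nu (a5 3 0 0 0 0) - nu (a5 2 1 0 0 0) - nu (a5 2 0 1 0 0) -
  nu (a5 2 0 0 1 0) + nu (a5 2 0 0 0 1) + nu (a5 1 1 1 0 0) -
  nu (a5 0 1 1 1 0) + nu (a5 0 1 1 0 1) + nu (a5 0 1 0 2 0) -
  nu (a5 0 1 0 1 1) + nu (a5 0 0 1 2 0) - nu (a5 0 0 1 1 1).
Proof.
rewrite /ratio5 pair_comb; first by rewrite !big_cons big_nil /=; lra.
by rewrite /= !in_Delta !mdeg_expo.
Qed.

Lemma ratio5_BR : BR R 3 (Delta n 3) ratio5.
Proof.
(* The constant 4 counts one four-point condition and three diagonal inequalities. *)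
apply: (@BR_almost_trop _ _ _ _ 4 n1) => C nu C0 h.
have diag b i j l : (mdeg b + 2)%N = 3%N ->
    nu (sh b i j) + nu (sh b i l) <= nu (sh b i i) + nu (sh b j l) + C.
  exact: almost_trop_diag.
have bd a b c e f : (a + b + c + e + f)%N = 1%N ->
    (mdeg (a5 a b c e f) + 2)%N = 3%N.
  by rewrite mdeg_expo => ->.
have e1 := diag (a5 1 0 0 0 0) i1 i3 i4 (bd 1 0 0 0 0 erefl).
have e2 := diag (a5 0 1 0 0 0) i4 i3 i5 (bd 0 1 0 0 0 erefl).
have e3 := diag (a5 0 0 1 0 0) i4 i1 i5 (bd 0 0 1 0 0 erefl).
have f1 := diag (a5 1 0 0 0 0) i1 i2 i4 (bd 1 0 0 0 0 erefl).
have f2 := diag (a5 0 1 0 0 0) i4 i1 i5 (bd 0 1 0 0 0 erefl).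
have f3 := diag (a5 0 0 1 0 0) i4 i2 i5 (bd 0 0 1 0 0 erefl).
have q := @almost_trop_four _ _ _ C nu (a5 1 0 0 0 0) i1 i5 i2 i3 h
  (bd 1 0 0 0 0 erefl).
move: e1 e2 e3 f1 f2 f3 q.
rewrite /sh !(expo1, expo2, expo3, expo4, expo5) pair_ratio5.
clear -C0.
move: (nu (a5 3 0 0 0 0)) (nu (a5 2 1 0 0 0)) (nu (a5 2 0 1 0 0))
  (nu (a5 2 0 0 1 0)) (nu (a5 2 0 0 0 1)) (nu (a5 1 1 1 0 0))
  (nu (a5 0 1 1 1 0)) (nu (a5 0 1 1 0 1)) (nu (a5 0 1 0 2 0))
  (nu (a5 0 1 0 1 1)) (nu (a5 0 0 1 2 0)) (nu (a5 0 0 1 1 1))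
  (nu (a5 1 0 1 1 0)) (nu (a5 1 0 1 0 1)) (nu (a5 1 1 0 1 0)) (nu (a5 1 1 0 0 1)).
move=> *; lra.
Qed.

Lemma pair_ratio5_nu5 : pair ratio5 nu5 < 0.
Proof.
have sw i j : i != j -> (i == j = false) * (j == i = false).
  by move=> /negbTE ij; rewrite ij eq_sym ij.
have nE a b c e f : nu5 (a5 a b c e f) = (bump5 b c e f)%:R.
  rewrite /nu5 !mnmE !(sw _ _ _ n12, sw _ _ _ n13, sw _ _ _ n14, sw _ _ _ n15,
    sw _ _ _ n23, sw _ _ _ n24, sw _ _ _ n25, sw _ _ _ n34, sw _ _ _ n35, sw _ _ _ n45, eqxx).
  by rewrite !mul0n !mul1n !add0n !addn0.
rewrite pair_ratio5 !nE; norm_natmul; lra.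
Qed.

Lemma nu5_dualpos b : (mdeg b + 2)%N = 3%N ->
  dualpos 3 b (fun g => nu5 (b + g)%mnm).
Proof.
move=> bd.
pose D i j (g : multinom n) : R := (dist (b i + b j + wt [set i; j] g) 1)%:R.
have Dpos i j : dualpos 3 b (D i j) by apply: dualpos_dist.
have nuE g : nu5 (b + g)%mnm = D i4 i5 g + D i3 i5 g + D i2 i5 g +
    (2 * [&& b i2 + g i2 == 1, b i3 + g i3 == 1 & b i4 + g i4 == 1])%N%:R.
  rewrite /nu5 /bump5 !mnmDE /D !wt_set2 // !natrD.
  by rewrite (addnACA (b i4) (g i4)) (addnACA (b i3) (g i3)) (addnACA (b i2) (g i2)).
have w4 (g : multinom n) : wt [set i2; i3; i4; i5] g = (g i2 + g i3 + g i4 + g i5)%N.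
  rewrite /wt finset.setUC big_setU1 /=; last first.
    by rewrite !inE !negb_or !(eq_sym i5) n25 n35 n45.
  by rewrite -/(wt [set i2; i3; i4] g) wt_set3 // addnC.
have g2 g : mdeg g = 2%N -> (g i2 + g i3 + g i4 + g i5 <= 2)%N.
  by move/(@wt_le2 _ [set i2; i3; i4; i5]); rewrite w4.
have b1 : (b i2 + b i3 + b i4 + b i5 <= 1)%N.
  rewrite -w4; have <- : mdeg b = 1%N by lia.
  by rewrite mdegE /wt [leqRHS](bigID (mem [set i2; i3; i4; i5])) /= leq_addr.
(* Then the bump is invisible: a [g] of degree 2 cannot raise three coordinates to 1. *)
have [b0|b0] := boolP ((b i2 + b i3 + b i4)%N == 0%N).
  apply: (@eq_dualpos _ _ _ _ bd _
    (fun g => D i4 i5 g + D i3 i5 g + D i2 i5 g)); last by do 2?apply: dualposD.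
  move=> g /g2 gle; rewrite nuE (_ : [&& _, _ & _] = false) ?addr0 //.
  by apply/negbTE; rewrite !negb_and; move/eqP: b0; lia.
have cut A : dualpos 3 b (fun g => (dist (wt A g) 1)%:R : R).
  exact: dualpos_cut.
have b5 : b i5 = 0%N by lia.
have [[b2 b3 b4]|[b2 b3 b4]|[b2 b3 b4]] : [\/
    [/\ b i2 = 0%N, b i3 = 0%N & b i4 = 1%N],
    [/\ b i2 = 0%N, b i3 = 1%N & b i4 = 0%N] |
    [/\ b i2 = 1%N, b i3 = 0%N & b i4 = 0%N]].
  move: b0 b1; rewrite b5.
  by case: (b i2) => [|[|?]]; case: (b i3) => [|[|?]]; case: (b i4) => [|[|?]] //= _ _;
    (constructor 1 + constructor 2 + constructor 3).
(* At [b = e_4] the bump sits at [e_2 + e_3] and turns the crossing cuts [{3, 5}] and [{2, 5}] into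
   the nested cuts [{5}] and [{2, 3, 5}]. The two other cases follow by permuting 2, 3 and 4. *)
- apply: (@eq_dualpos _ _ _ _ bd _ (fun g => D i4 i5 g +
    ((dist (wt [set i5] g) 1)%:R + (dist (wt [set i2; i3; i5] g) 1)%:R))).
    move=> g /g2 gle; rewrite nuE -!addrA; congr (_ + _).
    rewrite /D b2 b3 b4 b5 !wt_set2 // wt_set3 // /wt big_set1.
    move: (g i2) (g i3) (g i4) (g i5) gle.
    by case=> [|[|[|?]]] [|[|[|?]]] [|[|[|?]]] [|[|[|?]]] //= _; norm_natmul; lra.
  by do 2?apply: dualposD.
- apply: (@eq_dualpos _ _ _ _ bd _ (fun g => D i3 i5 g +
    ((dist (wt [set i5] g) 1)%:R + (dist (wt [set i2; i4; i5] g) 1)%:R))).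
    move=> g /g2 gle; rewrite nuE (addrC (D i4 i5 g)) -!addrA; congr (_ + _).
    rewrite /D b2 b3 b4 b5 !wt_set2 // wt_set3 // /wt big_set1.
    move: (g i2) (g i3) (g i4) (g i5) gle.
    by case=> [|[|[|?]]] [|[|[|?]]] [|[|[|?]]] [|[|[|?]]] //= _; norm_natmul; lra.
  by do 2?apply: dualposD.
- apply: (@eq_dualpos _ _ _ _ bd _ (fun g => D i2 i5 g +
    ((dist (wt [set i5] g) 1)%:R + (dist (wt [set i3; i4; i5] g) 1)%:R))).
    move=> g /g2 gle; rewrite nuE (addrC _ (D i2 i5 g)) -!addrA; congr (_ + _).
    rewrite /D b2 b3 b4 b5 !wt_set2 // wt_set3 // /wt big_set1.
    move: (g i2) (g i3) (g i4) (g i5) gle.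
    by case=> [|[|[|?]]] [|[|[|?]]] [|[|[|?]]] [|[|[|?]]] //= _; norm_natmul; lra.
  by do 2?apply: dualposD.
Qed.

Lemma ratio5_notin : ~ Cone (local_gens R 3 (Delta n 3)) ratio5.
Proof.
apply: Cone_local_gens_notin pair_ratio5_nu5 => b v bd; exact: nu5_dualpos.
Qed.

End GapFive.

Lemma gap (R : realType) (n d : nat) : (1 <= n)%N -> (2 <= d)%N ->
  ~ [\/ (n <= 3)%N, d = 2%N | n = 4%N /\ d = 3%N] ->
  exists w : {ffun Delta n d -> R^o}, BR R d (Delta n d) w /\
    ~ Cone (local_gens R d (Delta n d)) w.
Proof.
move=> n1 d2 nii.
have n4 : (4 <= n)%N by rewrite ltnNge; apply/negP => n3; apply: nii; constructor 1.
have d3 : (3 <= d)%N.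
  by rewrite ltn_neqAle d2 andbT; apply/eqP => ed; apply: nii; constructor 2.
have [d4|d4] := leqP 4 d.
  have [k dk] : exists k, d = k.+4 by exists (d - 4)%N; lia.
  subst d; have lt m : (m < 4)%N -> (m < n)%N by move=> m4; exact: leq_trans m4 n4.
  pose i1 := Ordinal (lt 0%N isT); pose i2 := Ordinal (lt 1%N isT).
  pose i3 := Ordinal (lt 2%N isT); pose i4 := Ordinal (lt 3%N isT).
  by exists (ratio4 R k i1 i2 i3 i4); split; [exact: ratio4_BR|exact: ratio4_notin].
have dE : d = 3%N by apply/eqP; rewrite eqn_leq d3 andbT -ltnS.
subst d; have n5 : (5 <= n)%N.
  by rewrite ltn_neqAle n4 andbT; apply/eqP => en; apply: nii; constructor 3.
have lt m : (m < 5)%N -> (m < n)%N by move=> m5; exact: leq_trans m5 n5.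
pose i1 := Ordinal (lt 0%N isT); pose i2 := Ordinal (lt 1%N isT).
pose i3 := Ordinal (lt 2%N isT); pose i4 := Ordinal (lt 3%N isT).
pose i5 := Ordinal (lt 4%N isT).
by exists (ratio5 R i1 i2 i3 i4 i5); split; [exact: ratio5_BR|exact: ratio5_notin].
Qed.

Theorem theorem1p1 (R : realType) (n d : nat) (n_ge1 : (1 <= n)%N)
    (d_ge2 : (2 <= d)%N) :
  ((forall S : {fset multinom n}, Mconvex d S ->
      BR R d S = Cone (local_gens R d S))
   <-> [\/ (n <= 3)%N, d = 2%N | n = 4%N /\ d = 3%N])
  /\ (~ [\/ (n <= 3)%N, d = 2%N | n = 4%N /\ d = 3%N] ->
      (Cone (local_gens R d (Delta n d)) `<` BR R d (Delta n d))%classic).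
Proof.
have DM := Mconvex_Delta d n_ge1.
have proper : ~ [\/ (n <= 3)%N, d = 2%N | n = 4%N /\ d = 3%N] ->
    (Cone (local_gens R d (Delta n d)) `<` BR R d (Delta n d))%classic.
  move=> /(gap R n_ge1 d_ge2)[w [wB wC]]; split.
    exact: Cone_local_gens_sub.
  by move=> /(_ _ wB).
split=> //; split=> [eqC|]; last by move=> h S; exact: BR_eq_Cone_of_cases.
apply: contrapT => /proper; rewrite -(eqC _ DM).
by case=> _; apply.
Qed.
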